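(* Let $M$ be the circle $\mathbb{S}^1$ or the interval $I=[0,1]$, and let $f\in\mathrm{Diff}_+^1(M)$. Then $f$ is $C^1$-undistorted if and only if $f$ has a hyperbolic periodic point, i.e. a point $x\in M$ with $f^q(x)=x$ and $(f^q)'(x)\neq 1$ for some positive integer $q$.
   Context: $I=[0,1]$, and $\mathbb{S}^1$ is $[0,1]$ with endpoints identified (i.e. $\mathbb{R}/\mathbb{Z}$); derivatives are taken in the standard coordinate. $\mathrm{Diff}_+^1(M)$ is the group (under composition) of orientation-preserving $C^1$ diffeomorphisms of $M$, a Polish group with the uniform $C^1$ topology. A pseudometric $d$ on a topological group $G$ is maximal if it is continuous, right-invariant, and for every continuous right-invariant pseudometric $\rho$ on $G$ there are constants $K,C$ with $\rho\le K\cdot d+C$. Any two maximal pseudometrics on $G$ are quasi-isometrically equivalent, and $\mathrm{Diff}_+^1(\mathbb{S}^1)$, $\mathrm{Diff}_+^1(I)$ admit maximal pseudometrics. For $G$ with a maximal pseudometric $d$, an element $f\in G$ is distorted in $G$ if the inclusion $\langle f\rangle\hookrightarrow G$ is not a quasi-isometric embedding (with respect to a right-invariant Cayley metric on $\langle f\rangle$ and $d$ on $G$), and undistorted otherwise; this is independent of the choice of $d$. For non-torsion $f$, the limit $\lim_{n\to\infty} d(f^n,e)/n$ exists, and $f$ is distorted if and only if it equals $0$. A diffeomorphism $f$ is called $C^1$-distorted if it is distorted in the Polish group $\mathrm{Diff}_+^1(M)$ or is a torsion element; otherwise it is $C^1$-undistorted. *)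

(* Defs.v *)
From HB Require Import structures.
From mathcomp Require Import all_boot all_order all_algebra.
From mathcomp Require Import all_classical all_reals all_analysis.
From mathcomp Require Import lra.

Set Implicit Arguments.
Unset Strict Implicit.
Unset Printing Implicit Defensive.

Import Order.TTheory GRing.Theory Num.Theory.
Import numFieldNormedType.Exports.

Local Open Scope classical_set_scope.
Local Open Scope ring_scope.

(* As with PreTopologicalNmodule in MathComp-Analysis, the two structures are
   only joined: the notions below do not depend on the continuity of the group
   operations. *)
#[short(type="preTopologicalGroupType")]
HB.structure Definition PreTopologicalGroup :=
  {G of Group G & Topological G}.

Section LargeScaleGeometry.
Variables (R : realType) (G : preTopologicalGroupType).
Implicit Types (d : G -> G -> R) (f : G).

Definition pseudometric d :=
  [/\ forall x y, 0 <= d x y,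
      forall x, d x x = 0,
      forall x y, d x y = d y x &
      forall x y z, d x z <= d x y + d y z].

Definition right_invariant d :=
  forall x y z, d (x * z)%g (y * z)%g = d x y.

Definition continuous_right_invariant_pseudometric d :=
  [/\ pseudometric d,
      continuous (fun p : G * G => d p.1 p.2) &
      right_invariant d].

Definition maximal_pseudometric d :=
  continuous_right_invariant_pseudometric d /\
  forall rho, continuous_right_invariant_pseudometric rho ->
    exists K C : R, forall x y, rho x y <= K * d x y + C.

Definition expgz f (k : int) : G :=
  match k with Posz n => (f ^+ n)%g | Negz n => (f ^- n.+1)%g end.

Definition cyclic_subgroup f : set G := range (expgz f).

Definition torsion f := exists2 n : nat, (0 < n)%N & (f ^+ n)%g = 1%g.

(* The word length of a b^-1 with respect to the generating set {f, f^-1};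
   only meaningful for a and b in the subgroup generated by f. *)
Definition cayley_dist f (a b : G) : R :=
  inf [set `|k|%N%:R | k in [set k : int | expgz f k = (a * b^-1)%g]].

Definition qi_embedded (A : set G) (dA d : G -> G -> R) :=
  exists K C : R, [/\ 1 <= K, 0 <= C &
    forall a b, A a -> A b ->
      K^-1 * dA a b - C <= d a b <= K * dA a b + C].

(* Any two maximal pseudometrics are quasi-isometric, so "for some d" may be
   read "for every d" as soon as a maximal pseudometric exists. *)
Definition distorted f :=
  exists2 d, maximal_pseudometric d &
    ~ qi_embedded (cyclic_subgroup f) (cayley_dist f) d.

End LargeScaleGeometry.
Arguments distorted R {G} f.

Inductive manifold1 := Circle | Interval.

Section Points.
Variables (R : realType) (M : manifold1).

(* The circle [0, 1] with 0 and 1 identified is represented by [0, 1[. *)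
Definition chart : interval R :=
  match M with Circle => `[0, 1[ | Interval => `[0, 1] end.

Record pt := Pt { coord : R; coordP : coord \in chart }.

HB.instance Definition _ := [isSub for coord].
HB.instance Definition _ := [Choice of pt by <:].

(* On the circle, the representative modulo 1 of coord y - coord x in
   [-1/2, 1/2[. *)
Definition displacement (x y : pt) : R :=
  let t := coord y - coord x in
  match M with Circle => t - (Num.floor (t + 2^-1))%:~R | Interval => t end.

Definition point_dist (x y : pt) : R := `|displacement x y|.

Lemma displacementE x y : exists2 k : int,
  (M = Interval -> k = 0) & displacement x y = coord y - coord x - k%:~R.
Proof.
rewrite /displacement; case: M => /=; last by exists 0; rewrite // subr0.
by exists (Num.floor (coord y - coord x + 2^-1)).
Qed.

Lemma point_dist_min x y (k : int) : (M = Interval -> k = 0) ->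
  point_dist x y <= `|coord y - coord x - k%:~R|.
Proof.
rewrite /point_dist /displacement; case: M => /= [_|/(_ erefl) ->]; last first.
  by rewrite subr0.
move: (coord y - coord x) => t; have /andP[] := floor_itv (t + 2^-1).
move: (Num.floor _) => n h1 h2.
rewrite intrD mulr1z in h2.
have [->//|/eqP kn] := eqVneq k n.
have [{}kn|{}kn] : (k + 1 <= n)%R \/ (n + 1 <= k)%R.
  by rewrite !lezD1; case: (ltgtP k n) kn; [left|right|].
- have : (k + 1)%:~R <= n%:~R :> R by rewrite ler_int.
  rewrite intrD mulr1z => kn'; rewrite (le_trans _ (ler_norm _))//.
  by rewrite ler_norml; apply/andP; split; lra.
- have : (n + 1)%:~R <= k%:~R :> R by rewrite ler_int.
  rewrite intrD mulr1z => kn'.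
  rewrite -(normrN (t - k%:~R)) (le_trans _ (ler_norm _))//.
  by rewrite ler_norml; apply/andP; split; lra.
Qed.

Lemma point_dist_le x y : point_dist x y <= `|coord y - coord x|.
Proof. by have := @point_dist_min x y 0 (fun=> erefl); rewrite subr0. Qed.

Lemma point_distxx x : point_dist x x = 0.
Proof.
apply/eqP; rewrite eq_le normr_ge0 andbT.
by rewrite (le_trans (point_dist_le _ _))// subrr normr0.
Qed.

Lemma point_dist_eq0 x y : point_dist x y = 0 -> x = y.
Proof.
move=> /eqP; rewrite normr_eq0 => /eqP; have [k kI ->] := displacementE x y.
move=> xyk; apply/val_inj => /=; have := coordP x; have := coordP y.
rewrite /chart; move: kI xyk; case: M => /= [_|->//]; last first.
  by move=> + _ _; rewrite subr0 => /eqP; rewrite subr_eq0 => /eqP.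
rewrite !in_itv/= => xyk /andP[y0 y1] /andP[x0 x1].
suff k0 : k = 0 by move: xyk; rewrite k0; lra.
have : k%:~R < 1%:~R :> R by lra.
have : (-1)%:~R < k%:~R :> R by rewrite intrN; lra.
rewrite !ltr_int; case: k {xyk} => [[|n]|[|n]] //.
Qed.

Lemma point_dist_sym x y : point_dist x y = point_dist y x.
Proof.
wlog suff h : x y / point_dist x y <= point_dist y x.
  by apply/eqP; rewrite eq_le !h.
rewrite {2}/point_dist; have [k kI ->] := displacementE y x.
have -> : `|coord x - coord y - k%:~R| = `|coord y - coord x - (- k)%:~R|.
  by rewrite -normrN intrN; congr `|_|; lra.
by apply: point_dist_min => /kI ->; rewrite oppr0.
Qed.

Lemma point_dist_triangle y x z :
  point_dist x z <= point_dist x y + point_dist y z.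
Proof.
rewrite {2 3}/point_dist; have [k kI ->] := displacementE x y.
have [l lI ->] := displacementE y z; apply: le_trans (ler_normD _ _).
have -> : coord y - coord x - k%:~R + (coord z - coord y - l%:~R) =
  coord z - coord x - (k + l)%:~R by rewrite intrD; lra.
by apply: point_dist_min => MI; rewrite kI// lI.
Qed.

HB.instance Definition _ := @isMetric.Build R pt point_dist
  point_distxx point_dist_eq0 point_dist_sym point_dist_triangle.

End Points.

Section Derivative.
Variables (R : realType) (M : manifold1).
Local Notation pt := (pt R M).
Implicit Types (f g : pt -> pt) (x y : pt).

Definition slope f x y : R := displacement (f x) (f y) / displacement x y.

(* One-sided at the endpoints of the interval, since y ranges over M. *)
Definition differentiable_at f x := cvg (slope f x y @[y --> x^']).

Definition deriv f x : R := lim (slope f x y @[y --> x^']).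

Definition C1 f := (forall x, differentiable_at f x) /\ continuous (deriv f).

Definition C1_diffeo f :=
  exists g, [/\ cancel f g, cancel g f, C1 f & C1 g].

Definition orientation_preserving f := forall x, 0 < deriv f x.

Lemma displacement_neq0 x y : y != x -> displacement x y != 0.
Proof.
apply: contra_neq => xy; apply/esym/point_dist_eq0.
by rewrite /point_dist xy normr0.
Qed.

Lemma nbhs_point_dist x (e : R) :
  0 < e -> \forall y \near x, point_dist x y < e.
Proof. by move=> e0; have := nbhsx_ballx x _ e0; rewrite ballEmdist. Qed.

Lemma point_accumulation x (e : R) : 0 < e ->
  exists2 y, y != x & point_dist x y < e.
Proof.
move=> e0; pose r := Num.min (e / 2) 4^-1.
have r0 : 0 < r by rewrite lt_min; apply/andP; split; lra.
have r4 : r <= 4^-1 by rewrite ge_min lexx orbT.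
have re : r < e by rewrite (@le_lt_trans _ _ (e / 2)) ?ge_min ?lexx//; lra.
have [t tx tP] : exists2 t : R, `|t - coord x| = r & t \in chart R M.
  have := coordP x; move: (coord x) => c; rewrite /chart => cM.
  have [c2|c2] := ltP c 2^-1.
    exists (c + r); first by rewrite [_ + r]addrC addrK gtr0_norm.
    by case: M cM; rewrite !in_itv/= => /andP[? ?]; apply/andP; split; lra.
  exists (c - r); first by rewrite addrAC subrr sub0r normrN gtr0_norm.
  by case: M cM; rewrite !in_itv/= => /andP[? ?]; apply/andP; split; lra.
exists (Pt tP).
  by apply: contra_eq_neq tx => <-/=; rewrite subrr normr0 lt_eqF.
by rewrite (le_lt_trans (point_dist_le _ _))//= tx.
Qed.

#[global] Instance pt_dnbhs_filter x : ProperFilter x^'.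
Proof.
apply: Build_ProperFilter => /nbhs_ballP[e/= e0]; rewrite ballEmdist => xe.
by have [y yx ye] := point_accumulation x e0; apply: (xe y).
Qed.

Lemma cvg_deriv f x : differentiable_at f x ->
  slope f x y @[y --> x^'] --> deriv f x.
Proof. by []. Qed.

Lemma derivP f x (l : R) : slope f x y @[y --> x^'] --> l ->
  differentiable_at f x /\ deriv f x = l.
Proof.
by move=> fl; split; [apply: cvgP fl | apply: cvg_lim fl; exact: Rhausdorff].
Qed.

Lemma slopeK f x y : y != x ->
  displacement (f x) (f y) = slope f x y * displacement x y.
Proof. by move=> yx; rewrite /slope divfK// displacement_neq0. Qed.

Lemma differentiable_at_continuous f x : differentiable_at f x ->
  {for x, continuous f}.
Proof.
move=> fx; have dx : displacement x y @[y --> x^'] --> (0 : R).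
  apply/cvgr0Pnorm_lt => e e0.
  rewrite near_withinE; have := nbhs_point_dist x e0.
  by apply: filterS => y ? _.
have : slope f x y * displacement x y @[y --> x^'] --> (0 : R).
  by rewrite -(mulr0 (deriv f x)); apply: cvgM => //; exact: cvg_deriv.
move=> /cvgr0Pnorm_lt h.
apply/(cvg_ballP (FF := nbhs_filter x)) => e e0.
move: (h e e0); rewrite near_withinE; apply: filterS => y.
have [-> _|yx /(_ isT)] := eqVneq y x.
  exact: ballxx.
by rewrite -slopeK// ballEmdist.
Qed.

Lemma differentiable_at_comp f g x : injective f ->
  differentiable_at f x -> differentiable_at g (f x) ->
  differentiable_at (g \o f) x /\
  deriv (g \o f) x = deriv g (f x) * deriv f x.
Proof.
move=> fI fx gx; apply: derivP.
have fx' : f y @[y --> x^'] --> (f x)^'.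
  move=> A /(differentiable_at_continuous fx) fA.
  rewrite -[_ A]/(nbhs x (fun y => y != x -> A (f y))).
  apply: (@filterS _ _ (nbhs_filter x) _ _ _ fA) => y /= + yx; apply.
  by apply: contra_neq yx; exact: fI.
have : slope g (f x) (f y) * slope f x y @[y --> x^'] -->
    deriv g (f x) * deriv f x.
  by apply: cvgM; [apply: cvg_comp fx' _; exact: cvg_deriv|exact: cvg_deriv].
apply: cvg_trans; apply: near_eq_cvg.
suff : \forall y \near x^', y != x.
  by apply: filterS => y yx; rewrite /slope mulrA divfK//;
     apply: displacement_neq0; apply: contra_neq yx; exact: fI.
by rewrite near_withinE; exact: nearW.
Qed.

Lemma differentiable_at_id x : differentiable_at id x /\ deriv id x = 1.
Proof.
apply: derivP.
have : (fun=> 1 : R) y @[y --> x^'] --> (1 : R) by exact: cvg_cst.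
apply: cvg_trans; apply: near_eq_cvg.
rewrite near_withinE; apply: nearW => y yx.
by rewrite /slope divff// displacement_neq0.
Qed.

Lemma C1_id : C1 id.
Proof.
split=> [x|]; first by case: (differentiable_at_id x).
have -> : deriv id = fun=> 1.
  by apply/funext => x; case: (differentiable_at_id x).
exact: cst_continuous.
Qed.

Lemma C1_comp f g : injective f -> C1 f -> C1 g -> C1 (g \o f).
Proof.
move=> fI [fd fc] [gd gc].
have h x := differentiable_at_comp fI (fd x) (gd (f x)).
split=> [x|]; first by case: (h x).
have -> : deriv (g \o f) = fun x => deriv g (f x) * deriv f x.
  by apply/funext => x; case: (h x).
move=> x; apply: (cvgM (FF := nbhs_filter x)); last exact: fc.
exact: (cvg_comp _ _ (differentiable_at_continuous (fd x)) (gc (f x))).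
Qed.

Lemma orientation_preserving_id : orientation_preserving id.
Proof. by move=> x; have [_ ->] := differentiable_at_id x. Qed.

Lemma orientation_preserving_comp f g : injective f -> C1 f -> C1 g ->
  orientation_preserving f -> orientation_preserving g ->
  orientation_preserving (g \o f).
Proof.
move=> fI [fd _] [gd _] f0 g0 x.
by have [_ ->] := differentiable_at_comp fI (fd x) (gd (f x)); exact: mulr_gt0.
Qed.

Lemma orientation_preserving_inv f g : cancel f g -> cancel g f ->
  C1 f -> C1 g -> orientation_preserving f -> orientation_preserving g.
Proof.
move=> fK gK [fd _] [gd _] f0 x.
have [_] := differentiable_at_comp (can_inj gK) (gd x) (fd (g x)).
have -> : f \o g = id by apply/funext => y /=; rewrite gK.
by have [_ ->] := differentiable_at_id x => fg1;
  rewrite -(pmulr_rgt0 _ (f0 (g x))) -fg1.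
Qed.

End Derivative.

Section DiffeomorphismGroup.
Variables (R : realType) (M : manifold1).
Local Notation pt := (pt R M).

Record diff1 := Diff1 {
  diff1_fun :> pt -> pt;
  diff1P : C1_diffeo diff1_fun /\ orientation_preserving diff1_fun }.

HB.instance Definition _ := gen_eqMixin diff1.
HB.instance Definition _ := gen_choiceMixin diff1.

Implicit Types f g h : diff1.

Lemma diff1_ext f g : diff1_fun f =1 diff1_fun g -> f = g.
Proof.
case: f g => [f fP] [g gP] /= /funext fg.
by case: _ / fg in gP *; rewrite (Prop_irrelevance fP gP).
Qed.

Lemma diff1_C1 f : C1 f.
Proof. by case: (diff1P f) => -[g []]. Qed.

Lemma diff1_inj f : injective f.
Proof. by case: (diff1P f) => -[g [/can_inj]]. Qed.

Lemma diff1_id_subproof :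
  C1_diffeo (@id pt) /\ orientation_preserving (@id pt).
Proof.
split; last exact: orientation_preserving_id.
by exists id; split=> //; exact: C1_id.
Qed.
Definition diff1_id := Diff1 diff1_id_subproof.

Lemma diff1_comp_subproof f g :
  C1_diffeo (f \o g) /\ orientation_preserving (f \o g).
Proof.
case: (diff1P f) (diff1P g) => -[f' [fK fK' fC fC']] f0.
move=> [[g' [gK gK' gC gC']] g0].
split; last by apply: orientation_preserving_comp => //; exact: (can_inj gK).
exists (g' \o f'); split; [exact: can_comp|exact: can_comp| |].
  by apply: C1_comp => //; exact: (can_inj gK).
by apply: C1_comp => //; exact: (can_inj fK').
Qed.
Definition diff1_comp f g := Diff1 (diff1_comp_subproof f g).

Lemma diff1_inv_exists f : exists g, cancel f (diff1_fun g).
Proof.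
case: (diff1P f) => -[g [fK gK fC gC]] f0.
suff gP : C1_diffeo g /\ orientation_preserving g by exists (Diff1 gP).
split; last exact: (orientation_preserving_inv fK gK).
by exists f; split.
Qed.
Definition diff1_inv f := projT1 (cid (diff1_inv_exists f)).

Lemma diff1_invK f : cancel f (diff1_inv f).
Proof. by rewrite /diff1_inv; case: cid. Qed.

Lemma diff1_compA : associative diff1_comp.
Proof. by move=> f g h; exact: diff1_ext. Qed.

Lemma diff1_comp_idl : left_id diff1_id diff1_comp.
Proof. by move=> f; exact: diff1_ext. Qed.

Lemma diff1_comp_idr : right_id diff1_id diff1_comp.
Proof. by move=> f; exact: diff1_ext. Qed.

Lemma diff1_comp_invl : left_inverse diff1_id diff1_inv diff1_comp.
Proof. by move=> f; apply: diff1_ext => x /=; exact: diff1_invK. Qed.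

Lemma diff1_comp_invr : right_inverse diff1_id diff1_inv diff1_comp.
Proof.
move=> f; apply: diff1_ext => x /=; apply: (@diff1_inj (diff1_inv f)).
exact: diff1_invK.
Qed.

HB.instance Definition _ := isGroup.Build diff1 diff1_compA diff1_comp_idl
  diff1_comp_idr diff1_comp_invl diff1_comp_invr.

(* The uniform C^1 topology: uniform convergence of f and of its derivative. *)
Definition C1_jet f : {uniform pt -> pt} * {uniform pt -> R} :=
  (diff1_fun f, deriv f).

HB.instance Definition _ := Topological.copy diff1 (initial_topology C1_jet).

Definition C1_distorted f := distorted R f \/ torsion f.

Definition C1_undistorted f := ~ C1_distorted f.

Definition hyperbolic_periodic_point f (x : pt) :=
  exists q : nat, [/\ (0 < q)%N, (f ^+ q)%g x = x & deriv (f ^+ q)%g x != 1].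

End DiffeomorphismGroup.

(* Main.v *)
Require Import Defs.
From mathcomp Require Import all_boot all_order all_algebra.
From mathcomp Require Import all_classical all_reals all_analysis.
From mathcomp Require Import lra ring.
(* The libraries above shadow the constructor [Interval]. *)
Import Defs.

(** The pseudometric d(f, g) = sup |log f' - log g'| is maximal. Up to a rotation,
    f fixes the base point; interpolating linearly between such an f and the
    identity splits f into about d(f, 1) factors close to the identity, and a
    continuous pseudometric is bounded near the identity, so it is at most affine
    in d. At a hyperbolic fixed point of f^q the chain rule makes |log (f^(qn))'|
    grow linearly in n, so f is undistorted. Conversely, if d(f^n, 1) grows
    linearly, then for f or its inverse some orbits of large length N have
    derivative at most exp(-cN). By Pliss's lemma such an orbit has many
    hyperbolic times, two of which are at nearby points, and the part of the orbit
    between them maps a small ball into itself as a contraction, whose fixed point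
    is a hyperbolic periodic point. *)

Set Implicit Arguments.
Unset Strict Implicit.
Unset Printing Implicit Defensive.

Import Order.TTheory GRing.Theory Num.Theory.
Import numFieldNormedType.Exports.

Local Open Scope classical_set_scope.
Local Open Scope ring_scope.

(** Rotations of the circle are at [logdist] 0 from the identity, so they have to be bounded
    separately, for every continuous right-invariant pseudometric. Once the base point is fixed, the
    oscillation of [log f'] controls [f] entirely: [f'] takes a value at least 1 and a value at most
    1, so a small oscillation forces [f'] near 1, hence [f] near the identity. This is why factors
    are measured by the ratios [f'(x) / f'(y)]. The two implications use [logdist] differently: at a
    hyperbolic point it bounds an arbitrary maximal pseudometric from below, while in the converse
    it is itself the maximal pseudometric that is tested. The decay rate is taken as [3 c] because
    it is spent in three parts: one drives the orbit through as many levels as Pliss's argument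
    needs, one is lost in passing from the orbit to a ball around it, and the last remains as
    contraction. *)

(** * Projection of the real line onto [M], and compactness *)

Section Parametrization.
Variables (R : realType) (M : manifold1).
Local Notation pt := (pt R M).
Implicit Types (x y z : pt) (s t : R).

(** Clamping on the interval makes the projection total and 1-Lipschitz, as the quotient map is on
    the circle, so that paths in [M] are straight lines in [R] in both cases. *)
Definition project s : R :=
  match M with
  | Circle => s - (Num.floor s)%:~R
  | Interval => Num.max 0 (Num.min 1 s)
  end.

Lemma project_chart s : project s \in chart R M.
Proof.
rewrite /project /chart; case: M; rewrite in_itv/=.
  have /andP[] := floor_itv s; rewrite intrD mulr1z => h1 h2.
  by apply/andP; split; lra.
by rewrite le_max lexx/= ge_max ler01 ge_min lexx.
Qed.

Definition proj s : pt := Pt (project_chart s).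

Lemma point_coord_range x : 0 <= coord x <= 1.
Proof.
have := coordP x; rewrite /chart; case: M x => x; rewrite in_itv/=.
  by case/andP=> -> /ltW ->.
by [].
Qed.

Lemma coordK : cancel (@coord R M) proj.
Proof.
move=> x; apply/val_inj => /=; have := coordP x.
rewrite /project /chart; case: M x => x; rewrite in_itv/= => /andP[x0 x1].
  suff -> : Num.floor (coord x) = 0 by rewrite subr0.
  by apply: floor_def; rewrite x0 add0r.
by rewrite (min_idPr x1) (max_idPr x0).
Qed.

Lemma proj_dist s t : point_dist (proj s) (proj t) <= `|t - s|.
Proof.
suff [k kM h] : exists2 k : int, (M = Interval -> k = 0) &
    `|project t - project s - k%:~R| <= `|t - s|.
  exact: le_trans (@point_dist_min R M (proj s) (proj t) k kM) h.
rewrite /project; case: M.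
  exists (Num.floor s - Num.floor t) => //.
  rewrite intrB; set u := _ - _ - _.
  by have -> : u = t - s by rewrite /u; ring.
exists 0 => //; rewrite subr0 /Num.max /Num.min.
have := ler_norm (t - s); have := ler_norm (s - t); rewrite (distrC s t).
by case: (ltP 1 s); case: (ltP 1 t); rewrite ?ltr01;
   case: (ltP 0 s); case: (ltP 0 t) => *;
   rewrite ler_norml; apply/andP; split; lra.
Qed.

Lemma proj_path x y : proj (coord x + displacement x y) = y.
Proof.
rewrite -[RHS]coordK; apply/val_inj => /=.
rewrite /project /displacement; case: M x y => x y; last first.
  by rewrite addrC subrK.
set k := Num.floor (_ + _).
have -> : coord x + (coord y - coord x - k%:~R) = coord y + (- k)%:~R.
  rewrite intrN; ring.
rewrite floorDrz ?intr_int// intrKfloor intrD; ring.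
Qed.

Lemma proj_dist_coord x t : point_dist x (proj (coord x + t)) <= `|t|.
Proof.
by rewrite -{1}(coordK x) (le_trans (proj_dist _ _))// addrAC subrr add0r.
Qed.

Lemma nbhs_pointP x (P : set pt) :
  (exists2 e, 0 < e & forall y, point_dist x y < e -> P y) <-> nbhs x P.
Proof.
split=> [[e e0 h]|].
  by apply: (@filterS _ _ (nbhs_filter x) _ _ h); exact: nbhs_point_dist.
by move=> /nbhs_ballP[e/= e0]; rewrite ballEmdist => h; exists e.
Qed.

Lemma continuous_pointP (f : pt -> R) x :
  {for x, continuous f} <->
  forall e, 0 < e -> exists2 r, 0 < r &
    forall y, point_dist x y < r -> `|f x - f y| < e.
Proof.
have FF := nbhs_filter x; split=> [/cvgrPdist_lt fx e e0|h].
  by apply/nbhs_pointP; exact: fx.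
by apply/cvgrPdist_lt => e e0; apply/nbhs_pointP; exact: h.
Qed.

Lemma proj_continuous : continuous proj.
Proof.
move=> s A /nbhs_pointP[e e0 eA].
apply/nbhs_ballP; exists e => //= t st; apply: eA.
apply: le_lt_trans (proj_dist _ _) _.
by rewrite distrC; exact: st.
Qed.

Lemma point_compact : compact [set: pt].
Proof.
have -> : [set: pt] = proj @` `[0, 1].
  apply/seteqP; split=> // x _; exists (coord x); last exact: coordK.
  by rewrite /= in_itv/= point_coord_range.
apply: continuous_compact; last exact: segment_compact.
by apply: continuous_subspaceT => s; exact: proj_continuous.
Qed.

Lemma point_hausdorff : hausdorff_space pt.
Proof.
rewrite ball_hausdorff => a b ab.
have r0 : 0 < point_dist a b / 2.
  rewrite divr_gt0// lt0r normr_ge0 andbT.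
  by apply: contra_neq ab => /point_dist_eq0.
exists (PosNum r0, PosNum r0) => /=.
rewrite !ballEmdist; apply/eqP; rewrite -subset0 => c [/= ac bc].
have := point_dist_triangle c a b; rewrite (point_dist_sym c b).
move: ac bc; rewrite /mdist/=; lra.
Qed.

Lemma point_max (f : pt -> R) : continuous f ->
  exists x, forall y, f y <= f x.
Proof.
move=> fc.
have A0 : [set: pt] !=set0 by exists (proj 0).
have [x _ h] := compact_EVT_max A0 point_compact (continuous_subspaceT fc).
by exists x => y; apply: h; rewrite inE.
Qed.

Lemma point_min (f : pt -> R) : continuous f ->
  exists x, forall y, f x <= f y.
Proof.
move=> fc.
have [|x h] := @point_max (fun y => - f y).
  by move=> y; apply: (@cvgN _ _ _ _ (nbhs_filter y)); exact: fc.
by exists x => y; rewrite -lerN2.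
Qed.

Lemma point_unif_continuous (f : pt -> R) (e : R) : continuous f -> 0 < e ->
  exists2 r, 0 < r & forall x y, point_dist x y < r -> `|f x - f y| < e.
Proof.
move=> fc e0.
have := point_compact; rewrite compact_near_coveringP.
move=> /(_ R (nbhs 0^'+)
  (fun r x => forall y, point_dist x y < r -> `|f x - f y| < e) _).
case=> [x _|r /= r0 h].
  have e2 : 0 < e / 2 by rewrite divr_gt0.
  have /continuous_pointP/(_ _ e2)[r r0 h] := fc x.
  exists ([set y | point_dist x y < r / 2], [set t : R | t < r / 2]) => /=.
    split; last by apply: nbhs_right_lt; rewrite divr_gt0.
    by apply: nbhs_point_dist; rewrite divr_gt0.
  move=> [y t] [/= xy tr] z yz.
  have h1 : `|f x - f y| < e / 2 by apply: h; lra.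
  have h2 : `|f x - f z| < e / 2.
    by apply: h; have := point_dist_triangle y x z; lra.
  have := ler_normB (f x - f z) (f x - f y).
  have -> : f x - f z - (f x - f y) = f y - f z by ring.
  lra.
exists (r / 2); first by rewrite divr_gt0.
move=> x y xy; apply: (h (r / 2)) => //=; last by rewrite divr_gt0.
by rewrite sub0r normrN gtr0_norm; lra.
Qed.

End Parametrization.
Arguments proj {R} M s.

(** * Mean value inequality *)

Section LocalToGlobal.
Variables (R : realType) (M : manifold1).
Local Notation pt := (pt R M).
Implicit Types (x y z : pt) (f : pt -> pt).

Lemma point_dist_le1 x y : point_dist x y <= 1.
Proof.
apply: le_trans (point_dist_le _ _) _; rewrite ler_norml.
have /andP[? ?] := point_coord_range x.
have /andP[? ?] := point_coord_range y.
by apply/andP; split; lra.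
Qed.

Lemma point_dist_ge0 x y : 0 <= point_dist x y.
Proof. exact: normr_ge0. Qed.

(** Continuous induction along the straight path from [x] to [y]: the supremum of the times at which
    the bound holds is attained, and it is 1 because the local bound would extend it further.
    Keeping [E] abstract serves two uses: the distance of two images and the variation of
    [excess]. *)
Lemma local_lipschitz (E : pt -> pt -> R) (b : R) x y : 0 <= b ->
  (forall z, E z z = 0) -> (forall z w, E z w = E w z) ->
  (forall z w v, E z v <= E z w + E w v) ->
  (forall z, point_dist x z <= point_dist x y -> exists2 r, 0 < r &
    forall w, point_dist z w < r -> E z w <= b * point_dist z w) ->
  E x y <= b * point_dist x y.
Proof.
move=> b0 E0 Esym Etri Eloc; set v := displacement x y.
pose g s := proj M (coord x + s * v).
have g_dist s t : point_dist (g s) (g t) <= `|t - s| * `|v|.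
  apply: le_trans (proj_dist _ _ _) _; rewrite -normrM.
  by rewrite le_eqVlt; apply/orP; left; apply/eqP; congr `|_|; ring.
have g0 : g 0 = x by rewrite /g mul0r addr0 coordK.
have g1 : g 1 = y by rewrite /g mul1r proj_path.
pose A := [set s | 0 <= s <= 1 /\ E x (g s) <= b * (s * `|v|)].
have A0 : A 0 by split; rewrite ?lexx ?ler01// g0 E0 mul0r mulr0.
have supA : has_sup A by split; [exists 0|exists 1 => s [/andP[]]].
set c := sup A.
have ubA s : A s -> s <= c by case: supA => _ /ub_le_sup; apply.
have c0 : 0 <= c := ubA _ A0.
have c1 : c <= 1 by apply: ge_sup; [exists 0|move=> s [/andP[]]].
have vE : `|v| = point_dist x y by [].
have [|r r0 hr] := Eloc (g c).
  rewrite -{1}g0; apply: le_trans (g_dist _ _) _.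
  by rewrite subr0 ger0_norm// vE ler_piMl// point_dist_ge0.
pose e := r / (`|v| + 1).
have v1 : 0 < `|v| + 1 by rewrite ltr_wpDl.
have e0 : 0 < e by rewrite divr_gt0.
have near_c s : `|s - c| < e -> E (g c) (g s) <= b * (`|s - c| * `|v|).
  move=> sc; apply: le_trans (hr _ _) _; last by rewrite ler_wpM2l// g_dist.
  apply: le_lt_trans (g_dist _ _) _.
  have : `|s - c| * (`|v| + 1) < r by rewrite -ltr_pdivlMr.
  by have := normr_ge0 (s - c); rewrite mulrDr mulr1; lra.
have Ac : A c.
  split; first by rewrite c0.
  have [s As cs] := sup_adherent e0 supA; rewrite -/c in cs.
  have sc : s <= c by exact: ubA.
  have sE : `|s - c| = c - s by rewrite distrC ger0_norm// subr_ge0.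
  have h1 : E (g c) (g s) <= b * ((c - s) * `|v|).
    by rewrite -sE near_c// sE; lra.
  have := Etri x (g s) (g c); rewrite (Esym (g s)).
  case: As => _ h2 h3; apply: le_trans h3 _.
  apply: le_trans (lerD h2 h1) _.
  by rewrite le_eqVlt; apply/orP; left; apply/eqP; ring.
have [c1'|c1'] := ltP c 1; last first.
  have ce : c = 1 by apply/eqP; rewrite eq_le c1.
  by case: Ac => _; rewrite ce g1 mul1r.
pose t := Num.min 1 (c + e / 2).
have ct : c < t by rewrite lt_min c1'/=; lra.
have te : t <= c + e / 2 by rewrite ge_min lexx orbT.
have t1 : t <= 1 by rewrite ge_min lexx.
suff : t <= c by rewrite leNgt ct.
apply: ubA; split; first by rewrite t1 andbT; lra.
have tE : `|t - c| = t - c by rewrite gtr0_norm// subr_gt0.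
apply: le_trans (Etri _ (g c) _) _.
have h1 : E (g c) (g t) <= b * ((t - c) * `|v|).
  by rewrite -tE near_c// tE; lra.
apply: le_trans (lerD Ac.2 h1) _.
by rewrite le_eqVlt; apply/orP; left; apply/eqP; ring.
Qed.

Lemma nbhs_point_dnbhs x (P : set pt) : (\forall y \near x^', P y) ->
  exists2 r, 0 < r & forall y, y != x -> point_dist x y < r -> P y.
Proof.
rewrite near_withinE => /nbhs_pointP[r r0 h].
by exists r => // y yx /h; apply.
Qed.

Lemma slope_near f x (e : R) : differentiable_at f x -> 0 < e ->
  exists2 r, 0 < r & forall y, point_dist x y < r ->
  `|displacement (f x) (f y) - deriv f x * displacement x y|
    <= e * point_dist x y.
Proof.
move=> /cvg_deriv/cvgrPdist_lt fx e0; have [r r0 h] := nbhs_point_dnbhs (fx _ e0).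
exists r => // y xy; have [->|yx] := eqVneq y x.
  have d0 z : displacement z z = 0 :> R.
    by apply/eqP; rewrite -normr_eq0; apply/eqP; exact: (@point_distxx R M z).
  by rewrite !d0 (@point_distxx R M x) !mulr0 subr0 normr0.
rewrite (slopeK f yx) -mulrBl normrM; apply: ler_wpM2r; first exact: normr_ge0.
by rewrite distrC; apply: ltW; exact: h.
Qed.

Lemma deriv_local_lipschitz f x (b : R) : differentiable_at f x ->
  `|deriv f x| < b -> exists2 r, 0 < r & forall y, point_dist x y < r ->
  point_dist (f x) (f y) <= b * point_dist x y.
Proof.
move=> fx fb; have e0 : 0 < b - `|deriv f x| by rewrite subr_gt0.
have [r r0 h] := slope_near fx e0; exists r => // y /h.
rewrite /point_dist mulrBl -normrM.
have := ler_normD (displacement (f x) (f y) - deriv f x * displacement x y)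
  (deriv f x * displacement x y); rewrite subrK; lra.
Qed.

(** The straight path stays in the ball around [x] that reaches [y], so derivatives are bounded only
    there; orbit arguments control them on small balls. *)
Lemma deriv_lipschitz f (a : R) x y : (forall z, differentiable_at f z) ->
  (forall z, point_dist x z <= point_dist x y -> `|deriv f z| <= a) ->
  point_dist (f x) (f y) <= a * point_dist x y.
Proof.
move=> fd fa.
have a0 : 0 <= a.
  by apply: le_trans (fa x _); rewrite ?point_distxx ?point_dist_ge0.
(* A local Lipschitz constant must exceed the derivative strictly; the slack [e] costs at most [e]
   in the end, distances being at most 1. *)
apply/ler_addgt0Pr => e e0.
have ae : 0 <= a + e by rewrite addr_ge0// ltW.
have := @local_lipschitz (fun z w => point_dist (f z) (f w)) (a + e) x y ae.
have xy := ler_wpM2l (ltW e0) (point_dist_le1 x y).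
rewrite mulrDl => h; rewrite (le_trans (h _ _ _ _)) => [//|||||].
- by move=> z; exact: point_distxx.
- by move=> z w; exact: point_dist_sym.
- by move=> z w v; exact: point_dist_triangle.
- move=> z /fa fz; apply: deriv_local_lipschitz => //; lra.
- by rewrite mulr1 in xy; rewrite lerD2l.
Qed.

End LocalToGlobal.

(** * Logarithmic derivatives and neighbourhoods in the C^1 topology *)

Section LogDerivative.
Variables (R : realType) (M : manifold1).
Local Notation pt := (pt R M).
Local Notation diff1 := (diff1 R M).
Implicit Types (x y z : pt) (f g h : diff1).

Lemma deriv_gt0 f x : 0 < deriv f x.
Proof. by case: (diff1P f). Qed.

Lemma diff1_differentiable f x : differentiable_at f x.
Proof. by case: (diff1_C1 f). Qed.

Arguments diff1_differentiable : clear implicits.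
Lemma diff1_deriv_continuous f : continuous (deriv f).
Proof. by case: (diff1_C1 f). Qed.

Arguments diff1_deriv_continuous : clear implicits.
Lemma diff1_continuous f : continuous f.
Proof.
by move=> x; apply: differentiable_at_continuous; exact: diff1_differentiable.
Qed.

Arguments diff1_continuous : clear implicits.
Lemma diff1_mulE f g x : (f * g)%g x = f (g x).
Proof. by []. Qed.

Lemma diff1_mulVK f x : (f^-1)%g (f x) = x.
Proof. by rewrite -diff1_mulE mulVg. Qed.

Lemma diff1_mulKV f x : f ((f^-1)%g x) = x.
Proof. by rewrite -diff1_mulE mulgV. Qed.

Lemma derivM f g x : deriv (f * g)%g x = deriv f (g x) * deriv g x.
Proof.
by have [] := differentiable_at_comp (@diff1_inj _ _ g)
  (diff1_differentiable g x) (diff1_differentiable f (g x)).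
Qed.

Lemma deriv1 x : deriv (1%g : diff1) x = 1.
Proof. by have [] := differentiable_at_id x. Qed.

Definition logderiv f x := ln (deriv f x).

Lemma logderivM f g x : logderiv (f * g)%g x = logderiv f (g x) + logderiv g x.
Proof. by rewrite /logderiv derivM lnM ?posrE ?deriv_gt0. Qed.

Lemma logderiv1 x : logderiv 1%g x = 0.
Proof. by rewrite /logderiv deriv1 ln1. Qed.

Lemma logderivV f x : logderiv (f^-1)%g (f x) = - logderiv f x.
Proof. by apply/eqP; rewrite -addr_eq0 -logderivM mulVg logderiv1. Qed.

Lemma logderiv_continuous f : continuous (logderiv f).
Proof.
move=> x; apply: (cvg_comp (deriv f) (@ln R)); first exact: diff1_deriv_continuous.
exact: continuous_ln (deriv_gt0 f x).
Qed.

Arguments logderiv_continuous : clear implicits.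
Lemma logderiv_bounded f : exists2 B, 0 <= B & forall x, `|logderiv f x| <= B.
Proof.
have fc y : {for y, continuous (fun z => `|logderiv f z|)}.
  apply: (cvg_norm (FF := nbhs_filter y)); exact: logderiv_continuous.
by have [x h] := point_max fc; exists `|logderiv f x|.
Qed.

(** Otherwise [f] would shrink all distances by a common factor below 1 while mapping [M] onto
    itself, and the supremum of all distances would be smaller than itself. This plays the part of
    [f'] having mean value 1. *)
Lemma exists_deriv_ge1 f : exists x, 1 <= deriv f x.
Proof.
have [x fx] := point_max (diff1_deriv_continuous f).
exists x; rewrite leNgt; apply/negP => x1.
have lip y z : point_dist (f y) (f z) <= deriv f x * point_dist y z.
  apply: deriv_lipschitz => [|w _]; first exact: diff1_differentiable.
  by rewrite gtr0_norm ?deriv_gt0.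
pose A : set R := [set d | exists y z, d = point_dist y z].
have p0 : pt := proj M 0.
have A0 : A !=set0 by exists (point_dist p0 p0); exists p0, p0.
have ubA : ubound A 1 by move=> _ [y [z ->]]; exact: point_dist_le1.
have le_sup y z : point_dist y z <= sup A.
  have : has_ubound A by exists 1.
  by move=> /ub_le_sup; apply; exists y, z.
have : sup A <= deriv f x * sup A.
  apply: ge_sup A0 _ => _ [y [z ->]].
  rewrite -(diff1_mulKV f y) -(diff1_mulKV f z); apply: le_trans (lip _ _) _.
  by rewrite ler_wpM2l// ltW// deriv_gt0.
have [y yp0 _] := point_accumulation p0 ltr01.
have sup0 : 0 < sup A.
  apply: lt_le_trans (le_sup p0 y); rewrite lt0r point_dist_ge0 andbT.
  by apply: contra_neq yp0 => /point_dist_eq0.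
by rewrite leNgt gtr_pMl// x1.
Qed.

Lemma exists_deriv_le1 f : exists x, deriv f x <= 1.
Proof.
have [x] := exists_deriv_ge1 (f^-1)%g; rewrite -{1}(diff1_mulKV f x).
move: ((f^-1)%g x) => y.
have : deriv (f^-1)%g (f y) * deriv f y = 1 by rewrite -derivM mulVg deriv1.
move=> h h1; exists y; rewrite -h ler_pMl ?deriv_gt0//.
Qed.

Lemma near_deriv_unif f (e : R) : 0 < e ->
  nbhs f [set g : diff1 | forall x, `|deriv f x - deriv g x| < e].
Proof.
move=> e0.
pose N : set {uniform pt -> R} := [set h | forall x, `|deriv f x - h x| < e].
have hN : nbhs (deriv f : {uniform pt -> R}) N.
  apply/uniform_nbhs; exists [set p : R * R | ball p.1 e p.2]; split.
    exact: entourage_ball (PosNum e0).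
  by move=> h /= hb x; exact: hb.
apply: (@initial_continuous _ _ (@C1_jet R M) f [set p | N p.2]).
by exists (setT, N); [split=> //=; exact: filterT|move=> [? ?] []].
Qed.

Lemma nbhs_diff1 f (A : set diff1) : nbhs f A -> exists2 e, 0 < e &
  forall g, (forall x, point_dist (f x) (g x) < e) ->
    (forall x, `|deriv f x - deriv g x| < e) -> A g.
Proof.
case=> _ [[U oU <-] /= fU UA].
have : nbhs (C1_jet f) U by exact: open_nbhs_nbhs.
case=> -[U1 U2] /= [/uniform_nbhs[E1 [entE1 E1U]] /uniform_nbhs[E2 [entE2 E2U]]].
move=> sub.
move: entE1 entE2; rewrite -2!entourage_ballE => -[e1 /= e10 sE1] [e2 /= e20 sE2].
exists (Num.min e1 e2) => [|g fg dfg]; first by rewrite lt_min; apply/andP.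
apply: UA; apply: (sub (C1_jet g)); split.
  apply: E1U => x _; apply: sE1 => /=; rewrite ballEmdist.
  by have := fg x; rewrite lt_min => /andP[].
apply: E2U => x _; apply: sE2 => /=.
by have := dfg x; rewrite lt_min => /andP[].
Qed.

End LogDerivative.
Arguments diff1_differentiable {R M} f x.
Arguments diff1_deriv_continuous {R M} f.
Arguments diff1_continuous {R M} f.
Arguments logderiv_continuous {R M} f.

(** * The pseudometric [logdist] *)

Section LogDerivativeDistance.
Variables (R : realType) (M : manifold1).
Local Notation pt := (pt R M).
Local Notation diff1 := (diff1 R M).
Implicit Types (x y z : pt) (f g h : diff1).

Definition logdist f g : R :=
  sup (range (fun x => `|logderiv f x - logderiv g x|)).

Lemma le_logdist f g x : `|logderiv f x - logderiv g x| <= logdist f g.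
Proof.
have [B _ fB] := logderiv_bounded f; have [C _ gC] := logderiv_bounded g.
have : has_ubound (range (fun x => `|logderiv f x - logderiv g x|)).
  exists (B + C) => _ [y _ <-]; apply: le_trans (ler_normB _ _) _.
  exact: lerD (fB y) (gC y).
by move=> /ub_le_sup; apply; exists x.
Qed.

Lemma logdist_le f g (b : R) :
  (forall x, `|logderiv f x - logderiv g x| <= b) -> logdist f g <= b.
Proof.
move=> h; apply: ge_sup => [|_ [x _ <-]//].
by exists `|logderiv f (proj M 0) - logderiv g (proj M 0)|; exists (proj M 0).
Qed.

Lemma logdist_pseudometric : pseudometric logdist.
Proof.
split=> [f g|f|f g|f g h].
- exact: le_trans (normr_ge0 _) (le_logdist f g (proj M 0)).
- apply/eqP; rewrite eq_le; apply/andP; split.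
    by apply: logdist_le => x; rewrite subrr normr0.
  exact: le_trans (normr_ge0 _) (le_logdist f f (proj M 0)).
- by apply/eqP; rewrite eq_le; apply/andP; split;
    apply: logdist_le => x; rewrite distrC le_logdist.
- apply: logdist_le => x.
  have := ler_distD (logderiv g x) (logderiv f x) (logderiv h x).
  move=> /le_trans; apply; apply: lerD; exact: le_logdist.
Qed.

Lemma logdist_right_invariant : right_invariant logdist.
Proof.
move=> f g h; apply/eqP; rewrite eq_le; apply/andP; split.
  apply: logdist_le => x; rewrite !logderivM opprD addrACA subrr addr0.
  exact: le_logdist.
apply: logdist_le => x.
have := le_logdist (f * h)%g (g * h)%g ((h^-1)%g x).
by rewrite !logderivM diff1_mulKV opprD addrACA subrr addr0.
Qed.

Lemma near_logdist f (e : R) : 0 < e ->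
  nbhs f [set g | logdist f g <= e].
Proof.
move=> e0; have [m mf] := point_min (diff1_deriv_continuous f).
set c := deriv f m; have c0 : 0 < c := deriv_gt0 f m.
(* The first bound keeps [g'] above [c / 2]; with [ln (1 + u) <= u] the second then brings the
   logarithms within [e]. *)
pose r := Num.min (c / 2) (c / 2 * e).
have r0 : 0 < r by rewrite lt_min !mulr_gt0 ?invr_gt0.
apply: (@filterS _ _ (nbhs_filter f) _ _ _ (near_deriv_unif f r0)) => g fg /=.
have lnB (a b : R) : c / 2 <= a -> c / 2 <= b -> `|a - b| <= c / 2 * e ->
    ln a - ln b <= e.
  move=> ca cb ab; have a0 : 0 < a by apply: lt_le_trans ca; rewrite divr_gt0.
  have b0 : 0 < b by apply: lt_le_trans cb; rewrite divr_gt0.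
  rewrite -ln_div ?posrE//.
  have -> : a / b = 1 + (a - b) / b by rewrite mulrBl divff ?gt_eqF// addrC subrK.
  apply: le_trans (le_ln1Dx _) _.
    by rewrite mulrBl divff ?gt_eqF// ltrBrDr addrC subrr divr_gt0.
  rewrite ler_pdivrMr//; apply: le_trans (ler_norm _) _.
  by apply: le_trans ab _; rewrite mulrC ler_wpM2l// ltW.
apply: logdist_le => x; have := fg x; rewrite lt_min => /andP[h1 h2].
have cf : c <= deriv f x := mf x.
have cg : c / 2 <= deriv g x.
  by have := ler_norm (deriv f x - deriv g x); lra.
have cf2 : c / 2 <= deriv f x by lra.
rewrite ler_norml; apply/andP; split; last exact: lnB (ltW h2).
by rewrite lerNl opprB; apply: lnB => //; rewrite distrC ltW.
Qed.

Lemma logdist_continuous : continuous (fun p : diff1 * diff1 => logdist p.1 p.2).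
Proof.
have [_ _ sym tri] := logdist_pseudometric.
move=> [f g]; have FF : Filter (nbhs (f, g)) by exact: nbhs_filter.
apply/cvgrPdist_le => e e0 /=.
have e2 : 0 < e / 2 by rewrite divr_gt0.
exists ([set h | logdist f h <= e / 2], [set h | logdist g h <= e / 2]) => /=.
  by split; exact: near_logdist.
move=> [f' g'] /= [ff gg].
have := tri f f' g; have := tri f' g' g; have := tri f' f g'.
have := tri f g g'; rewrite (sym f' f) (sym g' g); move: ff gg.
move: (logdist f f') (logdist g g') (logdist f g) (logdist f' g').
move: (logdist f' g) (logdist f g') => d1 d2 d3 d4 d5 d6 *.
by rewrite ler_norml; apply/andP; split; lra.
Qed.

Lemma logdist_continuous_right_invariant :
  continuous_right_invariant_pseudometric logdist.
Proof.
split; [exact: logdist_pseudometric|exact: logdist_continuous|].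
exact: logdist_right_invariant.
Qed.

End LogDerivativeDistance.

(** * Inverses of C^1 bijections *)

Section InverseFunction.
Variables (R : realType) (M : manifold1).
Local Notation pt := (pt R M).
Implicit Types (x y z u v : pt) (h g : pt -> pt).

Lemma continuous_cancel h g :
  continuous h -> cancel h g -> cancel g h -> continuous g.
Proof.
move=> hc hK gK; apply/continuous_closedP => A Acl.
have -> : g @^-1` A = h @` A.
  by apply/seteqP; split=> [u Au|_ [x Ax <-]]/=; [exists (g u)|rewrite hK].
apply: compact_closed; first exact: point_hausdorff.
apply: continuous_compact; first exact: continuous_subspaceT.
by rewrite -[A]setIT setIC; apply: compact_closedI => //; exact: point_compact.
Qed.

Lemma deriv_cancel h g u : continuous g -> cancel h g -> cancel g h ->
  differentiable_at h (g u) -> deriv h (g u) != 0 ->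
  differentiable_at g u /\ deriv g u = (deriv h (g u))^-1.
Proof.
move=> gc hK gK hd h0; apply: derivP.
have gu : g v @[v --> u^'] --> (g u)^'.
  move=> A /(gc u) gA.
  rewrite -[_ A]/(nbhs u (fun v => v != u -> A (g v))).
  apply: (@filterS _ _ (nbhs_filter u) _ _ _ gA) => v /= + vu; apply.
  by apply: contra_neq vu; exact: (can_inj gK).
have : (slope h (g u) (g v))^-1 @[v --> u^'] --> (deriv h (g u))^-1.
  by apply: cvgV => //; apply: cvg_comp gu _; exact: cvg_deriv.
apply: cvg_trans; apply: near_eq_cvg.
by apply: nearW => v; rewrite /slope !gK invf_div.
Qed.

(** Interpolations and rotations enter the group through this lemma: the inverse is continuous by
    compactness, and C^1 because the derivative does not vanish. *)
Lemma bijective_C1_diff1 h : C1 h -> orientation_preserving h ->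
  injective h -> (forall y, exists x, h x = y) ->
  exists F : diff1 R M, diff1_fun F =1 h.
Proof.
move=> [hd hc] h0 hI /choice[g gK].
have hK : cancel h g by move=> x; apply: hI; rewrite gK.
have h_cont : continuous h by move=> x; exact: differentiable_at_continuous.
have gc := continuous_cancel h_cont hK gK.
have gd u := deriv_cancel gc hK gK (hd (g u)) (lt0r_neq0 (h0 (g u))).
suff hP : C1_diffeo h /\ orientation_preserving h by exists (Diff1 hP).
split=> //; exists g; split=> //; split=> [u|]; first by case: (gd u).
have -> : deriv g = fun u => (deriv h (g u))^-1.
  by apply/funext => u; case: (gd u).
move=> u; apply: (cvgV (FF := nbhs_filter u)); first exact: lt0r_neq0.
exact: cvg_comp (gc u) (hc (g u)).
Qed.

End InverseFunction.

(** * The function [f - id] for maps fixing the base point *)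

Section Excess.
Variables (R : realType) (M : manifold1).
Local Notation pt := (pt R M).
Local Notation diff1 := (diff1 R M).
Implicit Types (x y z : pt) (f : diff1).

Lemma displacement_circle x y : M = Circle ->
  - 2^-1 <= displacement x y < 2^-1.
Proof.
rewrite /displacement; case: M x y => // x y _.
have /andP[] := floor_itv (coord y - coord x + 2^-1).
by rewrite intrD => *; apply/andP; split; lra.
Qed.

Lemma manifold1P : M = Circle \/ M = Interval.
Proof. by case: M; [left|right]. Qed.

Lemma int_small (k : int) : `|k%:~R| < 1 :> R -> k = 0.
Proof. by rewrite -intr_norm ltrz1; case: k => [[|n]|n]. Qed.

Lemma displacement_unique x y (w : R) (k : int) : (M = Interval -> k = 0) ->
  w = coord y - coord x - k%:~R -> `|w| < 2^-1 -> displacement x y = w.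
Proof.
move=> kM wE w2; have [l lM dE] := displacementE x y.
suff kl : l - k = 0 by rewrite dE wE (subr0_eq kl).
have [MC|MI] := manifold1P; last by rewrite kM ?lM.
apply: int_small; have := displacement_circle x y MC.
move: w2; rewrite wE dE intrB !ltr_norml => /andP[? ?] /andP[? ?].
by apply/andP; split; lra.
Qed.

Lemma coord_proj (s : R) : s \in chart R M -> coord (proj M s) = s.
Proof. by move=> sM; rewrite -[s in proj _ s]/(coord (Pt sM)) coordK. Qed.

Lemma coord_proj_inner (s : R) : 0 < s < 1 -> coord (proj M s) = s.
Proof.
move=> /andP[s0 s1]; apply: coord_proj; rewrite /chart.
by case: M; rewrite in_itv/= !ltW.
Qed.

Lemma coord_proj0 : coord (proj M 0) = 0 :> R.
Proof. by apply: coord_proj; rewrite /chart; case: M; rewrite in_itv/= lexx/= ?ltr01 ?ler01. Qed.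

Lemma coord_inner x : M = Circle -> x <> proj M 0 -> 0 < coord x < 1.
Proof.
move=> MC x0; have := coordP x; rewrite /chart [in X in _ \in X]MC in_itv/=.
move=> /andP[c0 ->]; rewrite andbT lt0r c0 andbT.
apply/eqP => c; apply: x0; apply/val_inj => /=.
by rewrite -[LHS]/(coord x) c -[RHS]/(coord (proj M 0)) coord_proj0.
Qed.

Lemma displacement_inner x y : M = Circle -> 0 < coord x < 1 ->
  point_dist x y < Num.min (coord x) (1 - coord x) ->
  displacement x y = coord y - coord x.
Proof.
move=> MC /andP[x0 x1]; rewrite lt_min /point_dist; have [k _ ->] := displacementE x y.
rewrite !ltr_norml => /andP[/andP[? ?] /andP[? ?]].
have := coordP y; rewrite /chart [in X in _ \in X]MC in_itv/= => /andP[? ?].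
suff -> : k = 0 by rewrite subr0.
by apply: int_small; rewrite ltr_norml; apply/andP; split; lra.
Qed.

Lemma coord_displacement0 y : M = Circle ->
  coord y = displacement (proj M 0) y + (displacement (proj M 0) y < 0)%R%:R.
Proof.
move=> MC; have := displacement_circle (proj M 0) y MC.
have [k _ dE] := displacementE (proj M 0) y; rewrite coord_proj0 subr0 in dE.
have := coordP y; rewrite /chart [in X in _ \in X]MC in_itv/= => /andP[y0 y1].
move=> /andP[d1 d2]; case: ltP => d0 /=.
  suff /eqP : k - 1 = 0 by rewrite subr_eq0 => /eqP k1; rewrite dE k1; lra.
  apply: int_small; rewrite intrB mulr1z ltr_norml; apply/andP; split; lra.
suff k0 : k = 0 by rewrite dE k0; lra.
by apply: int_small; rewrite ltr_norml; apply/andP; split; lra.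
Qed.

(** For [f] fixing the base point of the circle this is [F - id], where [F] is the lift of [f] with
    [F(0) = 0]: the jumps of the two coordinates at the base point cancel. *)
Definition excess f x := coord (f x) - coord x.

Section FixedBase.
Variable f : diff1.
Hypothesis fp0 : M = Circle -> f (proj M 0) = proj M 0.

Lemma excess_displacement x : exists2 r, 0 < r &
  forall y, point_dist x y < r ->
    excess f y - excess f x = displacement (f x) (f y) - displacement x y.
Proof.
have [MC|MI] := manifold1P; last first.
  exists 1 => // y _; rewrite /excess.
  have [k /(_ MI) -> ->] := displacementE x y.
  have [l /(_ MI) -> ->] := displacementE (f x) (f y).
  by rewrite !subr0; ring.
have fI := @diff1_inj _ _ f.
have [x0|/eqP x0] := eqVneq x (proj M 0).
  have fx0 : f x = x by rewrite x0 fp0.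
  (* With an error of half the slope, [displacement x (f y)] has the sign of [displacement x y]: [y]
     and [f y] lie on the same side of the base point, so both coordinates jump or neither does. *)
  have d2 : 0 < deriv f x / 2 by rewrite divr_gt0 ?deriv_gt0.
  have [r r0 h] := slope_near (diff1_differentiable f x) d2.
  exists r => // y /h.
  rewrite /excess fx0 subrr subr0 x0 (coord_displacement0 y MC).
  rewrite (coord_displacement0 (f y) MC) -x0 /point_dist.
  move: (displacement x (f y)) (displacement x y) => a b {h}.
  move: (deriv f x) (deriv_gt0 f x) => d d0; rewrite ler_norml => /andP[h1 h2].
  suff -> : (a < 0) = (b < 0) by ring.
  have [b0|b0] := ltP b 0.
    rewrite (ltr0_norm b0) in h1 h2.
    have db : d * b < 0 by rewrite nmulr_llt0.
    by lra.
  rewrite (ger0_norm b0) in h1 h2.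
  have db : 0 <= d * b by rewrite mulr_ge0// ltW.
  by apply/negbTE; rewrite -leNgt; lra.
have fx0 : f x <> proj M 0 by rewrite -(fp0 MC) => /fI.
have cx := coord_inner MC x0; have cfx := coord_inner MC fx0.
have mpos (c : R) : 0 < c < 1 -> 0 < Num.min c (1 - c).
  by move=> /andP[? ?]; rewrite lt_min; apply/andP; split; lra.
have [r r0 fr] : exists2 r, 0 < r & forall y, point_dist x y < r ->
    point_dist (f x) (f y) < Num.min (coord (f x)) (1 - coord (f x)).
  apply/nbhs_pointP.
  exact: (diff1_continuous f x _ (nbhs_point_dist (f x) (mpos _ cfx))).
exists (Num.min r (Num.min (coord x) (1 - coord x))).
  by rewrite lt_min r0 mpos.
move=> y; rewrite lt_min => /andP[/fr fxy xy].
rewrite (displacement_inner MC cx xy) (displacement_inner MC cfx fxy) /excess.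
by ring.
Qed.

Lemma excess_derivative x (e : R) : 0 < e -> exists2 r, 0 < r &
  forall y, point_dist x y < r ->
  `|excess f y - excess f x - (deriv f x - 1) * displacement x y|
    <= e * point_dist x y.
Proof.
move=> e0; have [r r0 h] := excess_displacement x.
have [r' r'0 h'] := slope_near (diff1_differentiable f x) e0.
exists (Num.min r r'); first by rewrite lt_min r0.
move=> y; rewrite lt_min => /andP[/h -> /h'].
by congr (`|_| <= _); ring.
Qed.

Lemma excess_local_lipschitz x (b : R) : `|deriv f x - 1| < b ->
  exists2 r, 0 < r & forall y, point_dist x y < r ->
  `|excess f x - excess f y| <= b * point_dist x y.
Proof.
move=> fb; have e0 : 0 < b - `|deriv f x - 1| by rewrite subr_gt0.
have [r r0 h] := excess_derivative x e0; exists r => // y /h {}h.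
rewrite distrC; move: h; set u := excess f y - excess f x.
rewrite [(_ - _) * point_dist _ _]mulrBl {2}/point_dist -normrM => h1.
rewrite -[u](subrK ((deriv f x - 1) * displacement x y)).
by apply: le_trans (ler_normD _ _) _; rewrite -lerBrDr.
Qed.

Lemma excess_continuous : continuous (excess f).
Proof.
move=> x; apply/continuous_pointP => e e0.
have [|r r0 h] := @excess_local_lipschitz x (`|deriv f x - 1| + 1).
  by rewrite ltrDl.
set b := `|_| + 1 in h; have b0 : 0 < b by rewrite ltr_wpDl.
exists (Num.min r (e / b)); first by rewrite lt_min r0 divr_gt0.
move=> y; rewrite lt_min => /andP[/h xy1 xy2]; apply: le_lt_trans xy1 _.
by rewrite mulrC -ltr_pdivlMr.
Qed.

End FixedBase.
End Excess.

(** * Linear interpolation between a diffeomorphism and the identity *)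

Section Interpolation.
Variables (R : realType) (M : manifold1) (f : diff1 R M).
Local Notation pt := (pt R M).
Implicit Types (x y z : pt) (s t : R).
Hypothesis fp0 : M = Circle -> f (proj M 0) = proj M 0.

(** On [0, 1] this is [(1 - t) s + t F(s)] for the lift [F]; monotonicity and surjectivity of the
    interpolation are obtained there, then carried to [M]. *)
Definition height t s := s + t * excess f (proj M s).

Lemma height_continuous t : continuous (height t).
Proof.
move=> s; apply: cvgD; first exact: cvg_id.
apply: cvgM; first exact: cvg_cst.
apply: (cvg_comp (proj M) (excess f)); first exact: proj_continuous.
exact: excess_continuous.
Qed.

Lemma inner_displacement s s' : 0 < s < 1 -> 0 < s' < 1 -> `|s' - s| < 2^-1 ->
  displacement (proj M s) (proj M s') = s' - s.
Proof.
move=> s01 s'01; apply: (@displacement_unique _ _ _ _ _ 0) => //.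
by rewrite !coord_proj_inner// subr0.
Qed.

Lemma height_derive t s : 0 < s < 1 ->
  derivable (height t) s 1 /\
  derive1 (height t) s = 1 + t * (deriv f (proj M s) - 1).
Proof.
move=> s01; have /andP[s0 s1] := s01.
set c := _ + _.
suff hc : h^-1 *: (height t (h + s) - height t s) @[h --> 0^'] --> c.
  split; last exact: (cvg_lim (@Rhausdorff R) hc).
  apply/cvg_ex; exists c; apply: cvg_trans hc; apply: near_eq_cvg.
  by apply: nearW => h /=; rewrite [h%:A]mulr1.
apply/cvgrPdist_le => e e0.
have e1 : 0 < e / (`|t| + 1) by rewrite divr_gt0// ltr_wpDl.
have [r r0 hr] := excess_derivative fp0 (proj M s) e1.
pose r' := Num.min (Num.min r 2^-1) (Num.min s (1 - s)).
have r'0 : 0 < r' by rewrite !lt_min r0 invr_gt0 ltr0n s0 subr_gt0.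
rewrite near_withinE; apply/nbhs_ballP; exists r' => // h.
rewrite -ball_normE /= sub0r normrN !lt_min => /andP[/andP[h1 h2] /andP[h3 h4]] h0.
have hs01 : 0 < h + s < 1.
  by move: h3 h4; rewrite !ltr_norml => /andP[? ?] /andP[? ?]; apply/andP; split; lra.
have dE : displacement (proj M s) (proj M (h + s)) = h.
  by rewrite inner_displacement ?addrK.
have := hr (proj M (h + s)); rewrite /point_dist dE => /(_ h1) {}hr.
rewrite -[c](mulKf h0) -[_ *: _]/(_ * _) -mulrBr normrM normfV.
rewrite ler_pdivrMl ?normr_gt0//.
have -> : h * c - (height t (h + s) - height t s) = - (t *
    (excess f (proj M (h + s)) - excess f (proj M s)
      - (deriv f (proj M s) - 1) * h)).
  by rewrite /c /height; ring.
rewrite normrN normrM.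
apply: le_trans (ler_wpM2l (normr_ge0 t) hr) _.
have ek : e = e / (`|t| + 1) * (`|t| + 1) by rewrite divfK// gt_eqF// ltr_wpDl.
rewrite {2}ek; move: (e / _) e1 => k k0.
have := mulr_ge0 (ltW k0) (normr_ge0 h); lra.
Qed.

Lemma interp_deriv_gt0 t x : 0 <= t <= 1 -> 0 < 1 + t * (deriv f x - 1).
Proof.
move=> /andP[t0 t1]; have := deriv_gt0 f x; move: (deriv f x) => d d0.
have -> : 1 + t * (d - 1) = (1 - t) + t * d by ring.
have [t1'|] := ltP t 1.
  by rewrite ltr_pwDl ?subr_gt0// mulr_ge0// ltW.
by move=> t1'; have -> : t = 1; [lra|rewrite subrr add0r mul1r].
Qed.

Lemma height_increasing t : 0 <= t <= 1 ->
  forall s s', 0 <= s -> s < s' -> s' <= 1 -> height t s < height t s'.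
Proof.
move=> t01 s s' s0 ss' s'1.
apply: (@gtr0_derive1_lt_cc _ _ 0 1) => //.
- by move=> u; rewrite in_itv/= => /(height_derive t)[].
- move=> u; rewrite in_itv/= => /(height_derive t)[_ ->].
  exact: interp_deriv_gt0.
- exact/continuous_subspaceT/height_continuous.
- by rewrite in_itv/= s0 (le_trans _ s'1)// ltW.
- by rewrite in_itv/= s'1 andbT (le_trans s0)// ltW.
Qed.

Lemma height1_interval s : M = Interval -> 0 <= s <= 1 ->
  height 1 s = coord (f (proj M s)).
Proof.
move=> MI s01; have sM : s \in chart R M by rewrite /chart MI in_itv.
by rewrite /height /excess mul1r (coord_proj sM) addrC subrK.
Qed.

(** At [t = 1] the function [height] is [f] in coordinates, so [f] is increasing and no positive
    point is sent to 0. Hence fixing the base point is a normalisation for the circle alone. *)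
Lemma interval_fixed0 : M = Interval -> f (proj M 0) = proj M 0.
Proof.
move=> MI; pose x := (f^-1)%g (proj M 0).
have fx : f x = proj M 0 by exact: diff1_mulKV.
have /andP[x0 x1] := point_coord_range x.
suff : ~~ (0 < coord x).
  by rewrite -leNgt => x0'; rewrite -{1}(_ : coord x = 0) ?coordK//; lra.
apply/negP => {}x0.
have i01 : 0 <= (1 : R) <= 1 by rewrite ler01 lexx.
have := height_increasing i01 (lexx 0) x0 x1.
rewrite !height1_interval ?lexx ?ler01 ?point_coord_range// coordK fx coord_proj0.
by rewrite ltNge; case/andP: (point_coord_range (f (proj M 0))) => ->.
Qed.

Lemma interval_fixed1 : M = Interval -> coord (f (proj M 1)) = 1.
Proof.
move=> MI; have i01 : 0 <= (1 : R) <= 1 by rewrite ler01 lexx.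
have c1 : coord (proj M 1) = 1 :> R.
  by apply: coord_proj; rewrite /chart MI in_itv.
pose x := (f^-1)%g (proj M 1).
have fx : f x = proj M 1 by exact: diff1_mulKV.
have /andP[x0 x1] := point_coord_range x.
have /andP[_ f1] := point_coord_range (f (proj M 1)).
have [x1'|x1'] := ltP (coord x) 1; last first.
  have p1x : proj M 1 = x by rewrite -(coordK x); congr proj; lra.
  by rewrite p1x fx c1.
have := height_increasing i01 x0 x1' (lexx 1).
rewrite !height1_interval ?lexx ?ler01 ?point_coord_range// coordK fx c1.
by rewrite ltNge f1.
Qed.

Lemma base_fixed : f (proj M 0) = proj M 0.
Proof.
by have [MC|MI] := manifold1P M; [exact: fp0|exact: interval_fixed0].
Qed.

Lemma height0 t : height t 0 = 0.
Proof. by rewrite /height /excess base_fixed subrr mulr0 addr0. Qed.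

Lemma height1 t : height t 1 = 1.
Proof.
rewrite /height; suff -> : excess f (proj M 1) = 0 by rewrite mulr0 addr0.
have [MC|MI] := manifold1P M.
  have -> : proj M 1 = proj M 0 :> pt.
    by apply/val_inj; rewrite /= /project MC floor1 floor0 subrr subr0.
  by rewrite /excess base_fixed subrr.
rewrite /excess interval_fixed1// coord_proj ?subrr//.
by rewrite /chart MI in_itv/= ler01 lexx.
Qed.

Lemma height_le t s s' : 0 <= t <= 1 -> 0 <= s -> s <= s' -> s' <= 1 ->
  height t s <= height t s'.
Proof.
move=> t01 s0; rewrite le_eqVlt => /orP[/eqP->//|ss'] s'1.
by apply: ltW; exact: height_increasing.
Qed.

Section Fraction.
Variable t : R.
Hypothesis t01 : 0 <= t <= 1.

Definition interp x := proj M (coord x + t * excess f x).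

Lemma coord_interp x : coord (interp x) = coord x + t * excess f x.
Proof.
apply: coord_proj.
have hE : coord x + t * excess f x = height t (coord x).
  by rewrite /height coordK.
rewrite hE; move: (coord x) (coordP x) => c; rewrite /chart.
have h0 : 0 <= c -> c <= 1 -> 0 <= height t c.
  by move=> *; rewrite -(height0 t) height_le.
have hE' := height1 t.
have [MC|MI] := manifold1P M; rewrite ?MC ?MI !in_itv/= => /andP[c0 c1].
  apply/andP; split; first by apply: h0 => //; exact: ltW.
  by rewrite -[ltRHS]hE'; exact: height_increasing.
apply/andP; split; first exact: h0.
by rewrite -[leRHS]hE'; exact: height_le.
Qed.

Lemma interpE x : coord (interp x) = height t (coord x).
Proof. by rewrite coord_interp /height coordK. Qed.

Lemma interp_inj : injective interp.
Proof.
move=> x y xy; apply/val_inj; rewrite -[LHS]/(coord x) -[RHS]/(coord y).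
have : height t (coord x) = height t (coord y) by rewrite -!interpE xy.
have /andP[x0 x1] := point_coord_range x.
have /andP[y0 y1] := point_coord_range y.
by case: (ltgtP (coord x) (coord y)) => // /height_increasing h /eqP;
   rewrite ?(lt_eqF (h _ t01 _ _)) ?(gt_eqF (h _ t01 _ _)).
Qed.

Lemma interp_surj y : exists x, interp x = y.
Proof.
have hc : {within `[0, 1], continuous (height t)}.
  exact/continuous_subspaceT/height_continuous.
have hy : Num.min (height t 0) (height t 1) <= coord y
    <= Num.max (height t 0) (height t 1).
  by rewrite height0 height1 min_l ?max_r ?ler01// point_coord_range.
have [c] := IVT ler01 hc hy.
rewrite in_itv/= => /andP[c0 c1] cy; exists (proj M c).
apply/val_inj; rewrite -[LHS]/(coord (interp _)) -[RHS]/(coord y) -cy interpE.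
rewrite coord_proj// /chart.
have [MC|MI] := manifold1P M; rewrite ?MC ?MI in_itv/= c0//=.
have := coordP y; rewrite /chart [in X in _ \in X]MC in_itv/= -cy => /andP[_].
have [//|c1'] := ltP c 1; have -> : c = 1 by lra.
by rewrite height1 ltxx.
Qed.

Lemma interp_displacement x : exists2 r, 0 < r & forall y, point_dist x y < r ->
  displacement (interp x) (interp y) =
  (1 - t) * displacement x y + t * displacement (f x) (f y).
Proof.
have [r r0 hr] := excess_displacement fp0 x.
(* Displacements below 1/4 keep their convex combination below 1/2, the range in which
   [displacement_unique] identifies it. *)
have d4 : (0 : R) < 4^-1 by rewrite invr_gt0.
have [r' r'0 hr'] : exists2 r', 0 < r' & forall y, point_dist x y < r' ->
    point_dist (f x) (f y) < 4^-1.
  apply/nbhs_pointP.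
  exact: (diff1_continuous f x _ (nbhs_point_dist (f x) d4)).
exists (Num.min r (Num.min r' 4^-1)); first by rewrite !lt_min r0 r'0.
move=> y; rewrite !lt_min => /andP[/hr xy /andP[/hr' fxy xy4]].
have [k kM kE] := displacementE x y.
apply: (@displacement_unique _ _ _ _ _ k) => //.
  rewrite !coord_interp.
  have -> : coord y + t * excess f y - (coord x + t * excess f x) - k%:~R =
    coord y - coord x - k%:~R + t * (excess f y - excess f x) by ring.
  by rewrite xy -kE; ring.
move: fxy xy4; rewrite /point_dist.
move: (displacement x y) (displacement (f x) (f y)) => a b.
have /andP[t0 t1] := t01.
rewrite !ltr_norml => /andP[b1 b2] /andP[a1 a2].
have t1' : 0 <= 1 - t by rewrite subr_ge0.
have := ler_wpM2l t0 (ltW b1); have := ler_wpM2l t0 (ltW b2).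
have := ler_wpM2l t1' (ltW a1); have := ler_wpM2l t1' (ltW a2).
by move=> *; apply/andP; split; lra.
Qed.

Lemma interp_deriv x : differentiable_at interp x /\
  deriv interp x = 1 + t * (deriv f x - 1).
Proof.
apply: derivP.
have : 1 - t + t * slope f x y @[y --> x^'] --> 1 + t * (deriv f x - 1).
  have -> : 1 + t * (deriv f x - 1) = 1 - t + t * deriv f x by ring.
  apply: cvgD; first exact: cvg_cst.
  by apply: cvgM; [exact: cvg_cst|apply: cvg_deriv; exact: diff1_differentiable].
apply: cvg_trans; apply: near_eq_cvg; rewrite near_withinE.
apply/nbhs_pointP; have [r r0 h] := interp_displacement x; exists r => // y xy yx.
by rewrite /slope h// mulrDl mulrA mulfK ?displacement_neq0.
Qed.

Lemma interp_diff1 : exists F : diff1 R M,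
  forall x, coord (F x) = coord x + t * excess f x /\
    deriv F x = 1 + t * (deriv f x - 1).
Proof.
have C1i : C1 interp.
  split=> [x|]; first by case: (interp_deriv x).
  have -> : deriv interp = fun x => 1 + t * (deriv f x - 1).
    by apply/funext => x; case: (interp_deriv x).
  move=> x; have FF := nbhs_filter x; apply: cvgD; first exact: cvg_cst.
  apply: cvgM; first exact: cvg_cst.
  by apply: cvgB; [exact: diff1_deriv_continuous|exact: cvg_cst].
have opi : orientation_preserving interp.
  by move=> x; case: (interp_deriv x) => _ ->; exact: interp_deriv_gt0.
have [F FE] := bijective_C1_diff1 C1i opi interp_inj interp_surj.
have {}FE : diff1_fun F = interp by apply/funext.
by exists F => x; rewrite FE coord_interp; case: (interp_deriv x).
Qed.

End Fraction.
End Interpolation.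

(** * Right-invariant pseudometrics on a group *)

Section PseudometricGroup.
Variables (R : realType) (G : preTopologicalGroupType) (d : G -> G -> R).
Hypotheses (dP : pseudometric d) (dR : right_invariant d).
Implicit Types (f g h : G).

Lemma dist_quotient f g : d f g = d (f * g^-1)%g 1%g.
Proof. by rewrite -(dR f g (g^-1)%g) mulgV. Qed.

Lemma dist_mul1 f g : d (f * g)%g 1%g <= d f 1%g + d g 1%g.
Proof.
have [_ _ _ tri] := dP; apply: le_trans (tri _ g _) _.
by rewrite -{2}(mul1g g) dR.
Qed.

Lemma dist_expg1 f n : d (f ^+ n)%g 1%g <= n%:R * d f 1%g.
Proof.
elim: n => [|n IH].
  by have [_ -> _ _] := dP; rewrite mul0r.
rewrite expgS; apply: le_trans (dist_mul1 _ _) _.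
by rewrite -addn1 natrD mulrDl mul1r addrC lerD2r.
Qed.

End PseudometricGroup.

(** * Rotations of the circle *)

Section Rotation.
Variables (R : realType) (M : manifold1).
Local Notation pt := (pt R M).
Local Notation diff1 := (diff1 R M).
Implicit Types (x y z : pt) (f g : diff1) (a b : R).
Hypothesis MC : M = Circle.

Definition rotate a x := proj M (coord x + a).

Lemma coord_proj_circle (s : R) : coord (proj M s) = s - (Num.floor s)%:~R.
Proof. by rewrite /= /project MC. Qed.

Lemma displacement_circleE x y : displacement x y =
  coord y - coord x - (Num.floor (coord y - coord x + 2^-1))%:~R.
Proof. by move: MC; rewrite /displacement; case: M x y. Qed.

Lemma coord_rotate a x : exists k : int, coord (rotate a x) = coord x + a + k%:~R.
Proof.
exists (- Num.floor (coord x + a)).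
by rewrite intrN coord_proj_circle.
Qed.

Lemma displacement_circle_eq (u v x y : pt) (k : int) :
  coord v - coord u = coord y - coord x + k%:~R ->
  displacement u v = displacement x y.
Proof.
move=> uv; have floorE (t : R) :
    Num.floor (t + k%:~R + 2^-1) = Num.floor (t + 2^-1) + k.
  by rewrite addrAC floorDrz ?intr_int// intrKfloor.
rewrite !displacement_circleE uv floorE intrD; ring.
Qed.

Lemma displacement_rotate a x y :
  displacement (rotate a x) (rotate a y) = displacement x y.
Proof.
have [k kE] := coord_rotate a x; have [l lE] := coord_rotate a y.
by apply: (@displacement_circle_eq _ _ _ _ (l - k)); rewrite kE lE intrB; ring.
Qed.

Lemma rotateD a b x : rotate a (rotate b x) = rotate (a + b) x.
Proof.
have [k kE] := coord_rotate b x.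
apply/val_inj; rewrite -[LHS]/(coord (proj M (coord (rotate b x) + a))).
rewrite -[RHS]/(coord (proj M (coord x + (a + b)))) kE !coord_proj_circle.
have -> : coord x + b + k%:~R + a = coord x + (a + b) + k%:~R by ring.
by rewrite floorDrz ?intr_int// intrKfloor intrD; ring.
Qed.

Lemma rotate0 x : rotate 0 x = x.
Proof. by rewrite /rotate addr0 coordK. Qed.

Lemma rotate_deriv a x : differentiable_at (rotate a) x /\
  deriv (rotate a) x = 1.
Proof.
apply: derivP.
have : (fun=> 1 : R) y @[y --> x^'] --> (1 : R) by exact: cvg_cst.
apply: cvg_trans; apply: near_eq_cvg; rewrite near_withinE.
by apply: nearW => y yx; rewrite /slope displacement_rotate divff ?displacement_neq0.
Qed.

Lemma rotation_exists a : exists f, diff1_fun f = rotate a.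
Proof.
have [| | | |F FE] := @bijective_C1_diff1 R M (rotate a).
- split=> [x|]; first by case: (rotate_deriv a x).
  have -> : deriv (rotate a) = fun=> 1.
    by apply/funext => x; case: (rotate_deriv a x).
  exact: cst_continuous.
- by move=> x; case: (rotate_deriv a x) => _ ->.
- move=> x y xy; rewrite -(rotate0 x) -(rotate0 y) -(addNr a) -!rotateD.
  by rewrite xy.
- by move=> y; exists (rotate (- a) y); rewrite rotateD subrr rotate0.
by exists F; apply/funext.
Qed.

Definition rotation a := projT1 (cid (rotation_exists a)).

Lemma rotationE a x : rotation a x = rotate a x.
Proof. by rewrite /rotation; case: cid => /= F ->. Qed.

Lemma deriv_rotation a x : deriv (rotation a) x = 1.
Proof.
by rewrite /rotation; case: cid => /= F ->; case: (rotate_deriv a x).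
Qed.

Lemma rotation_expg a n : (rotation a ^+ n)%g = rotation (n%:R * a).
Proof.
apply: diff1_ext => x; rewrite rotationE; elim: n x => [|n IH] x.
  by rewrite mul0r rotate0.
by rewrite expgS diff1_mulE IH rotationE rotateD -addn1 natrD mulrDl mul1r addrC.
Qed.

End Rotation.

(** * Maximality of [logdist] *)

Section Maximality.
Variables (R : realType) (M : manifold1) (d : diff1 R M -> diff1 R M -> R).
Local Notation pt := (pt R M).
Local Notation diff1 := (diff1 R M).
Implicit Types (x y z : pt) (f g h : diff1).
Hypothesis dC : continuous_right_invariant_pseudometric d.

Lemma near_id_dist_lt1 : exists2 e, 0 < e & forall g : diff1,
  (forall x, point_dist x (g x) < e) ->
  (forall x, `|1 - deriv g x| < e) -> d g 1%g < 1.
Proof.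
have [[dge0 d0 dsym dtri] dcont dR] := dC.
have := dcont (1%g, 1%g).
have FF : Filter (nbhs ((1%g : diff1), (1%g : diff1))) by exact: nbhs_filter.
move/cvgrPdist_lt => /(_ 1 ltr01)[[U V] /= [Un Vn] UV].
have [e e0 he] := nbhs_diff1 Un; exists e => // g g1 g2.
have V1 : V 1%g := nbhs_singleton Vn.
have Ug : U g by apply: he => x; rewrite ?deriv1.
have := UV (g, 1%g) (conj Ug V1); rewrite /= d0 sub0r normrN.
by apply: le_lt_trans; exact: ler_norm.
Qed.

(** As [f'] is at least 1 somewhere and at most 1 somewhere, ratios at most [1 + eta] force
    [|f' - 1| <= eta]. The base point being fixed, [excess] is then at most [2 eta] in absolute
    value, and [eta = e / 4] puts [f] in the given neighbourhood. *)
Lemma near_id_base_dist_lt1 : exists2 E, 1 < E & forall f,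
  (M = Circle -> f (proj M 0) = proj M 0) ->
  (forall x y, deriv f x <= E * deriv f y) -> d f 1%g < 1.
Proof.
have [e e0 he] := near_id_dist_lt1; pose eta := e / 4.
have eta0 : 0 < eta by rewrite divr_gt0.
exists (1 + eta); first by rewrite ltrDl.
move=> f fp0 fE.
have [u u1] := exists_deriv_ge1 f; have [v v1] := exists_deriv_le1 f.
have fclose x : `|deriv f x - 1| <= eta.
  have := fE x v; have := fE u x; have := deriv_gt0 f x.
  move: (deriv f x) (deriv f u) (deriv f v) u1 v1 => a b c b1 c1 a0 h1 h2.
  have h3 : (1 + eta) * c <= (1 + eta) * 1 by rewrite ler_wpM2l// addr_ge0// ltW.
  rewrite ler_norml; apply/andP; split; last by lra.
  have [a1|a1] := leP 1 a; first by lra.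
  have : eta * a <= eta * 1 by rewrite ler_wpM2l// ltW.
  lra.
apply: he => x; last first.
  by rewrite distrC; apply: le_lt_trans (fclose x) _; rewrite /eta; lra.
have ex0 : excess f (proj M 0) = 0 by rewrite /excess base_fixed// subrr.
have := @local_lipschitz R M (fun z w => `|excess f z - excess f w|)
  (eta + eta) (proj M 0) x (addr_ge0 (ltW eta0) (ltW eta0)).
rewrite /= ex0 sub0r normrN => h.
apply: le_lt_trans (point_dist_le _ _) _.
rewrite -/(excess f x); apply: le_lt_trans (h _ _ _ _) _.
- by move=> z; rewrite subrr normr0.
- by move=> z w; rewrite distrC.
- by move=> z w v'; exact: ler_distD.
- move=> z _; apply: excess_local_lipschitz => //.
  by apply: le_lt_trans (fclose z) _; rewrite ltrDl.
have ee0 : 0 <= eta + eta by rewrite addr_ge0// ltW.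
have := ler_wpM2l ee0 (point_dist_le1 (proj M 0) x).
by rewrite mulr1 => /le_lt_trans; apply; rewrite /eta; lra.
Qed.

(* The quotient of f by its interpolation with the identity has derivative
   f' / (1 + t (f' - 1)), an increasing function of f': the oscillation of log f'
   is thus shared between the interpolation and the quotient, and [t] is chosen
   so that the interpolation gets the factor [Q]. *)
Lemma interp_split f (E Q : R) : (M = Circle -> f (proj M 0) = proj M 0) ->
  1 < E -> 1 < Q -> (forall x y, deriv f x <= E * Q * deriv f y) ->
  exists h, [/\ h (proj M 0) = proj M 0,
    forall x y, deriv h x <= Q * deriv h y &
    forall x y, deriv (f * h^-1)%g x <= E * deriv (f * h^-1)%g y].
Proof.
move=> fp0 E1 Q1 fEQ.
have [a fa] := point_max (diff1_deriv_continuous f).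
have [b fb] := point_min (diff1_deriv_continuous f).
have a1 : 1 <= deriv f a by have [x] := exists_deriv_ge1 f; move/le_trans; apply.
have b1 : deriv f b <= 1 by have [x] := exists_deriv_le1 f; apply: le_trans.
have b0 := deriv_gt0 f b; have ab := fEQ a b.
have := fun t => @interp_deriv_gt0 R M f t b.
move: (deriv f a) (deriv f b) fa fb a1 b1 b0 ab => u v fa fb u1 v1 v0 uv vpos.
have Q0 : 0 < Q by lra.
(* If the ratios of [f] are already at most [Q], then [h] is [f] itself. Otherwise [u > Q v], which
   is what makes [t] at most 1. *)
have [uQ|Qu] := leP u (Q * v).
  exists f; split; first exact: base_fixed.
    move=> x y; apply: le_trans (fa x) _; apply: le_trans uQ _.
    by rewrite ler_wpM2l// ltW.
  by move=> x y; rewrite mulgV !deriv1 mulr1 ltW.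
pose D := u - 1 + Q * (1 - v).
have D0 : 0 < D by rewrite /D; lra.
pose t := (Q - 1) / D.
have t01 : 0 <= t <= 1.
  rewrite divr_ge0 ?subr_ge0 ?(ltW Q1) ?(ltW D0)//=.
  by rewrite ler_pdivrMr// mul1r /D; lra.
have tQ : 1 + t * (u - 1) = Q * (1 + t * (v - 1)).
  have : t * D = Q - 1 by rewrite divfK// gt_eqF.
  by rewrite /D; lra.
have [h hE] := interp_diff1 fp0 t01; have /andP[t0 t1] := t01.
have hd x : deriv h x = 1 + t * (deriv f x - 1) by case: (hE x).
have hp : 0 < 1 + t * (v - 1) by exact: vpos.
exists h; split.
- apply/val_inj; rewrite -[LHS]/(coord (h _)); case: (hE (proj M 0)) => -> _.
  by rewrite /excess base_fixed// subrr mulr0 addr0.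
- move=> x y; rewrite !hd; apply: (@le_trans _ _ (1 + t * (u - 1))).
    by rewrite lerD2l ler_wpM2l// lerB.
  by rewrite tQ; apply: ler_wpM2l; [exact: ltW|rewrite lerD2l ler_wpM2l// lerB].
have hq x : deriv (f * h^-1)%g (h x) * (1 + t * (deriv f x - 1)) = deriv f x.
  by rewrite -hd -derivM mulgVK.
move=> x y; rewrite -(diff1_mulKV h x) -(diff1_mulKV h y).
move: ((h^-1)%g x) ((h^-1)%g y) => {}x {}y.
have := hq x; have := hq y.
have hx : 0 < 1 + t * (deriv f x - 1) by rewrite -hd; exact: deriv_gt0.
have hy : 0 < 1 + t * (deriv f y - 1) by rewrite -hd; exact: deriv_gt0.
move: hx hy; have := fa x; have := fb y; have := deriv_gt0 f x; have := deriv_gt0 f y.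
move: (deriv (f * h^-1)%g (h x)) (deriv (f * h^-1)%g (h y)) => p q.
move: (deriv f x) (deriv f y) => r s s0 r0 vs ru hx hy qs pr.
have t1' : 0 <= 1 - t by rewrite subr_ge0.
have pu : p * (1 + t * (u - 1)) <= u.
  rewrite -(ler_pM2r hx) mulrAC pr.
  have := ler_wpM2r t1' ru; lra.
have qv : v <= q * (1 + t * (v - 1)).
  rewrite -(ler_pM2r hy).
  rewrite [leRHS]mulrAC qs.
  have := ler_wpM2r t1' vs; lra.
rewrite tQ in pu; set V := 1 + _ in pu qv hp.
rewrite -(ler_pM2r (mulr_gt0 Q0 hp)); apply: le_trans pu _.
apply: le_trans uv _.
have -> : E * q * (Q * V) = E * Q * (q * V) by ring.
by rewrite ler_wpM2l// mulr_ge0// ltW// (lt_trans ltr01).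
Qed.

(** Each [interp_split] peels off a quotient with ratios at most [E], at distance less than 1 from
    the identity. The exponent starts at 1 because both factors of a splitting must exceed 1. *)
Lemma base_dist_bounded : exists2 E, 1 < E & forall n f,
  (M = Circle -> f (proj M 0) = proj M 0) ->
  (forall x y, deriv f x <= E ^+ n.+1 * deriv f y) -> d f 1%g <= n.+1%:R.
Proof.
have [[_ _ dsym dtri] _ dR] := dC.
have [E E1 hE] := near_id_base_dist_lt1; exists E => //.
elim=> [|n IH] f fp0 fE; first by apply: ltW; exact: hE.
have Q1 : 1 < E ^+ n.+1 by rewrite exprn_egt1.
rewrite exprS in fE; have [h [hp0 hQ qE]] := interp_split fp0 E1 Q1 fE.
have h1 : d h 1%g <= n.+1%:R by exact: IH.
have kp0 : M = Circle -> (f * h^-1)%g (proj M 0) = proj M 0.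
  by move=> MC; rewrite -{1}hp0 diff1_mulE diff1_mulVK fp0.
have := hE _ kp0 qE; have := dtri f h 1%g.
by rewrite (dist_quotient dR f h) -addn1 natrD; lra.
Qed.

(** A rotation by [a] is the [m]-th power of the rotation by [a / m], and a fixed [m > 1 / e] brings
    the latter within [e] of the identity for all [a] in [0, 1]. *)
Lemma rotation_dist_bounded (MC : M = Circle) : exists C, forall a,
  0 <= a <= 1 -> d (rotation MC a) 1%g <= C.
Proof.
have [dP _ dR] := dC; have [e e0 he] := near_id_dist_lt1.
pose m := (Num.trunc e^-1).+1.
have m0 : (0 : R) < m%:R by rewrite ltr0n.
exists m%:R => a /andP[a0 a1].
have -> : rotation MC a = (rotation MC (a / m%:R) ^+ m)%g.
  by rewrite rotation_expg mulrCA divff ?mulr1// gt_eqF.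
apply: le_trans (dist_expg1 dP dR _ _) _; rewrite ler_piMr ?ler0n//.
apply/ltW/he => x; last by rewrite deriv_rotation subrr normr0.
rewrite rotationE; apply: le_lt_trans (proj_dist_coord _ _) _.
rewrite ger0_norm ?divr_ge0// ltr_pdivrMr//; apply: le_lt_trans a1 _.
by rewrite mulrC -ltr_pdivrMr// mul1r truncnS_gt.
Qed.

Lemma logdist_dominates : exists K C, forall f g, d f g <= K * logdist f g + C.
Proof.
have [dP _ dR] := dC; have [E E1 hE] := base_dist_bounded.
have lnE : 0 < ln E by rewrite ln_gt0.
(* On the circle, the rotation taking the base point to its image is divided out; this leaves the
   derivative unchanged and costs a bounded distance. *)
have [C hC] : exists C, forall f, exists g, [/\ M = Circle -> g (proj M 0) = proj M 0,
    forall x, deriv g x = deriv f x & d f 1%g <= d g 1%g + C].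
  have [MC|MI] := manifold1P M; last first.
    by exists 0 => f; exists f; split => //; [move=> MC; have := etrans (esym MC) MI|rewrite addr0].
  have [C hC] := rotation_dist_bounded MC; exists C => f.
  pose r := rotation MC (coord (f (proj M 0))).
  have rd x : deriv (r^-1)%g x = 1.
    have := derivM (r^-1)%g r ((r^-1)%g x); rewrite mulVg deriv1.
    by rewrite deriv_rotation mulr1 diff1_mulKV.
  exists (r^-1 * f)%g; split.
  - move=> _; rewrite diff1_mulE; apply: (@diff1_inj _ _ r).
    by rewrite diff1_mulKV rotationE /rotate coord_proj0 add0r coordK.
  - by move=> x; rewrite derivM rd mul1r.
  - rewrite -{1}(mulVKg r f) addrC; apply: le_trans (dist_mul1 dP dR _ _) _.
    by rewrite lerD2r hC// point_coord_range.
exists (2 / ln E), (C + 1) => f0 g0.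
rewrite (dist_quotient dR) (dist_quotient (@logdist_right_invariant R M)).
move: (f0 * g0^-1)%g => f {f0 g0}; have [g [gp0 gE fg]] := hC f.
have Lf x : `|ln (deriv f x)| <= logdist f 1%g.
  by have := le_logdist f 1%g x; rewrite logderiv1 subr0.
move: (logdist f 1%g) Lf => r Lf.
have r0 : 0 <= r := le_trans (normr_ge0 _) (Lf (proj M 0)).
(* Logarithmic derivatives within [[-r, r]] have ratios at most [exp (2 r)], which is [E] to the
   power [q]. Rounding [q] up to [n.+1] costs the 1 in [C + 1]. *)
pose q := 2 * r / ln E; have q0 : 0 <= q by rewrite divr_ge0 ?mulr_ge0// ltW.
have /andP[nq qn] := truncn_itv q0; set n := Num.trunc q in nq qn.
have gn : d g 1%g <= n.+1%:R.
  apply: hE => // x y; rewrite !gE.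
  have En : 0 < E ^+ n.+1 by rewrite exprn_gt0// (lt_trans ltr01).
  rewrite -ler_ln ?posrE ?mulr_gt0 ?deriv_gt0// lnM ?posrE ?deriv_gt0//.
  rewrite lnXn ?(lt_trans ltr01)// -mulr_natl.
  have := Lf x; have := Lf y; rewrite !ler_norml => /andP[? ?] /andP[? ?].
  move: qn; rewrite /q ltr_pdivrMr// => qn; lra.
have -> : 2 / ln E * r = q by rewrite /q mulrAC.
by move: gn; rewrite -addn1 natrD; lra.
Qed.

End Maximality.

(** * Pliss's lemma *)

Section HyperbolicTimes.
Variable R : realType.

(* Pliss's argument: the time [k] is the last one at which the partial sum is
   at least [- j * W], so every later partial sum lies below the one at [k]. *)
Lemma hyperbolic_time (S : nat -> R) (W : R) (N j : nat) :
  0 < W -> S 0%N = 0 -> (forall k, S k <= S k.+1 + W) -> S N < - (j%:R * W) ->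
  exists k, [/\ (k < N)%N, - (j%:R * W) <= S k < - (j%:R * W) + W &
    forall l, (k < l <= N)%N -> S l <= S k].
Proof.
move=> W0 S0 SW SN.
pose P k := (k <= N)%N && (- (j%:R * W) <= S k).
have P0 : exists k, P k.
  by exists 0%N; rewrite /P S0 oppr_le0 mulr_ge0// ltW.
have PN k : P k -> (k <= N)%N by case/andP.
case: (ex_maxnP P0 PN) => k /andP[kN Sk] kmax.
have {}kN : (k < N)%N.
  by rewrite ltn_neqAle kN andbT; apply: contraTneq Sk => ->; rewrite -ltNge.
have later l : (k < l <= N)%N -> S l < - (j%:R * W).
  move=> /andP[kl lN]; rewrite ltNge; apply/negP => Sl.
  have := kmax l; rewrite /P lN Sl => /(_ isT).
  by rewrite leqNgt kl.
exists k; split=> //; last by move=> l /later Sl; apply: le_trans (ltW Sl) Sk.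
(* At [k + 1] the sum is already below the level, and one step descends by at most [W]. *)
rewrite Sk/=; apply: le_lt_trans (SW k) _; rewrite ltrD2r.
by apply: later; rewrite ltnSn.
Qed.

End HyperbolicTimes.

(** * From decay along an orbit to a hyperbolic periodic point *)

Section Contraction.
Variables (R : realType) (M : manifold1).
Local Notation pt := (pt R M).
Local Notation diff1 := (diff1 R M).
Implicit Types (x y z w : pt) (g h : diff1).

(** Pigeonhole on cells of length [1 / m.+1]: the cell number runs from 0 to [m.+1], the last being
    reached at coordinate 1, which makes [m.+2] cells for [m.+3] points. *)
Lemma close_pair (m : nat) (u : 'I_m.+3 -> pt) :
  exists i j, i != j /\ point_dist (u i) (u j) < m.+1%:R^-1.
Proof.
pose cell (x : pt) : nat := Num.trunc (coord x * m.+1%:R).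
have cellP x : (cell x)%:R <= coord x * m.+1%:R < (cell x).+1%:R.
  by apply: truncn_itv; rewrite mulr_ge0//; case/andP: (point_coord_range x).
have cell_lt x : (cell x < m.+2)%N.
  rewrite ltnS -(ler_nat R); case/andP: (cellP x) => /le_trans + _; apply.
  by rewrite ler_piMl//; case/andP: (point_coord_range x).
pose c i : 'I_m.+2 := Ordinal (cell_lt (u i)).
have : ~~ injectiveb c.
  by apply/negP => /injectiveP/leq_card; rewrite !card_ord ltnn.
move=> /injectivePn[i [j ij cij]]; exists i, j; split=> //.
apply: le_lt_trans (point_dist_le _ _) _.
have {}cij : cell (u i) = cell (u j) by move/(congr1 val): cij.
have := cellP (u i); have := cellP (u j); rewrite cij -addn1 natrD.
move=> /andP[h1 h2] /andP[h3 h4]; rewrite -[_^-1]mul1r ltr_pdivlMr//.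
rewrite -[X in _ * X](@ger0_norm R)// -normrM mulrBl ltr_norml.
by apply/andP; split; lra.
Qed.

Lemma logderiv_expgS g n x :
  logderiv (g ^+ n.+1)%g x = logderiv (g ^+ n)%g x + logderiv g ((g ^+ n)%g x).
Proof. by rewrite expgS logderivM addrC. Qed.

Lemma deriv_expR g x : deriv g x = expR (logderiv g x).
Proof. by rewrite lnK ?posrE ?deriv_gt0. Qed.

Lemma contracting_fixed_point g y (q r : R) : 0 <= q < 1 -> 0 < r ->
  (forall z, point_dist y z <= 3 * r -> deriv g z <= q) ->
  point_dist y (g y) <= (1 - q) * r ->
  exists2 z, g z = z & deriv g z < 1.
Proof.
move=> /andP[q0 q1] r0 gq gy.
pose A := (fun s => proj M (coord y + s)) @` `[- r, r].
have AE z : A z <-> point_dist y z <= r.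
  split=> [[s /=]|yz].
    rewrite in_itv/= -ler_norml => sr <-; exact: le_trans (proj_dist_coord _ _) sr.
  by exists (displacement y z); rewrite ?proj_path//= in_itv/= -ler_norml.
have lip z w : A z -> A w -> point_dist (g z) (g w) <= q * point_dist z w.
  move=> /AE yz /AE yw; apply: deriv_lipschitz.
    exact: diff1_differentiable.
  move=> v vz; rewrite gtr0_norm ?deriv_gt0// gq//.
  have := point_dist_triangle z y v; have := point_dist_triangle y z w.
  by rewrite (point_dist_sym z y); lra.
have Ay : A y by apply/AE; rewrite point_distxx ltW.
have Ag z : A z -> A (g z).
  move=> Az; apply/AE; have := lip _ _ Ay Az; have := point_dist_triangle (g y) y (g z).
  have := ler_wpM2l q0 ((AE z).1 Az).
  lra.
have Ac : compact A.
  apply: continuous_compact; last exact: segment_compact.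
  apply: continuous_subspaceT => s; apply: (cvg_comp (fun s => coord y + s) (proj M)).
    by apply: cvgD; [exact: cvg_cst|exact: cvg_id].
  exact: proj_continuous.
have dc : continuous (fun z => point_dist z (g z)).
  move=> z; apply/continuous_pointP => e e0.
  have e2 : 0 < e / 2 by rewrite divr_gt0.
  have /nbhs_pointP[s s0 hs] := diff1_continuous g z _ (nbhs_point_dist (g z) e2).
  exists (Num.min s (e / 2)); first by rewrite lt_min s0.
  move=> w; rewrite lt_min => /andP[/hs/= zw1 zw2].
  have := point_dist_triangle w z (g z); have := point_dist_triangle (g w) w (g z).
  have := point_dist_triangle z w (g w); have := point_dist_triangle (g z) z (g w).
  rewrite (point_dist_sym (g w) (g z)) (point_dist_sym w z).
  move: zw1 zw2; move: (point_dist z w) (point_dist (g z) (g w)) => a b.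
  move: (point_dist z (g z)) (point_dist w (g w)) => {}c d.
  move: (point_dist w (g z)) (point_dist z (g w)) => u v *.
  by rewrite ltr_norml; apply/andP; split; lra.
have A0 : A !=set0 by exists y.
have [z] := compact_EVT_min A0 Ac (continuous_subspaceT dc).
rewrite inE => Az zmin; exists z; last first.
  by apply: le_lt_trans (gq _ _) q1; move/AE : Az; lra.
apply/esym/point_dist_eq0/eqP; rewrite eq_le point_dist_ge0 andbT leNgt.
apply/negP => d0.
have := zmin (g z); rewrite inE => /(_ (Ag _ Az)).
have := lip _ _ Az (Ag _ Az); move=> /[swap] /le_trans /[apply].
by rewrite leNgt gtr_pMl// q1.
Qed.

(* A ball around [y] is carried along the orbit of [y] without being enlarged, so
   that the uniform continuity of the logarithmic derivative, at scale [r],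
   compares the orbits of its points with that of [y]. *)
Lemma hyperbolic_time_contraction g y (c r : R) n : 0 < c ->
  (forall x z, point_dist x z <= r -> `|logderiv g x - logderiv g z| < c) ->
  (forall l, (l <= n)%N -> logderiv (g ^+ l)%g y <= - (c + c) *+ l) ->
  forall l, (l <= n)%N -> forall z, point_dist y z <= r ->
  logderiv (g ^+ l)%g z <= - c *+ l.
Proof.
move=> c0 gr gy.
have follow l : (forall z, point_dist y z <= r ->
    logderiv (g ^+ l)%g z <= - c *+ l) ->
  forall z, point_dist y z <= r ->
    logderiv g ((g ^+ l)%g z) <= logderiv g ((g ^+ l)%g y) + c.
  move=> gl z yz.
  have : point_dist ((g ^+ l)%g y) ((g ^+ l)%g z) <= r.
    apply: le_trans (yz); rewrite -[leRHS]mul1r; apply: deriv_lipschitz.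
      exact: diff1_differentiable.
    move=> v yv; rewrite gtr0_norm ?deriv_gt0// deriv_expR -expR0 ler_expR.
    apply: le_trans (gl v (le_trans yv yz)) _.
    by rewrite mulNrn oppr_le0 mulrn_wge0// ltW.
  move=> /gr; rewrite ltr_norml => /andP[h1 h2]; lra.
(* The induction also carries the comparison with [y]; the first half keeps [g ^+ l] from expanding
   the ball, which lets [follow] treat the next iterate. *)
suff H l : (l <= n)%N -> forall z, point_dist y z <= r ->
    logderiv (g ^+ l)%g z <= - c *+ l /\
    logderiv (g ^+ l)%g z <= logderiv (g ^+ l)%g y + c *+ l.
  by move=> l ln z yz; case: (H l ln z yz).
elim: l => [_ z _|l IH ln z yz].
  by rewrite expg0 !logderiv1 !mulr0n addr0 lexx.
have gl v : point_dist y v <= r -> logderiv (g ^+ l)%g v <= - c *+ l.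
  by move=> /(IH (ltnW ln))[].
have h2 : logderiv (g ^+ l.+1)%g z <= logderiv (g ^+ l.+1)%g y + c *+ l.+1.
  rewrite !logderiv_expgS mulrSr.
  have := follow l gl z yz; have [_] := IH (ltnW ln) z yz.
  lra.
split=> //; apply: le_trans h2 _; have := gy _ ln.
rewrite !mulNrn mulrnDl; lra.
Qed.

Lemma logderiv_expgD g l k x : logderiv (g ^+ (l + k))%g x =
  logderiv (g ^+ l)%g ((g ^+ k)%g x) + logderiv (g ^+ k)%g x.
Proof. by rewrite expgnDr logderivM. Qed.

(** The number [m.+3] of hyperbolic times that the pigeonhole requires depends on [g] and [c] only;
    this is why a large [N] suffices, uniformly in [x]. *)
Lemma decay_hyperbolic g (c : R) : 0 < c -> exists N0 : nat, forall N x,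
  (N0 <= N)%N -> logderiv (g ^+ N)%g x <= - (c + c + c) *+ N ->
  exists z, hyperbolic_periodic_point g z.
Proof.
move=> c0; have [B B0 gB] := logderiv_bounded g.
pose W := B + 1; have W0 : 0 < W by rewrite ltr_wpDl.
have [r' r'0 hr'] := point_unif_continuous (logderiv_continuous g) c0.
pose r := r' / 6; have r0 : 0 < r by rewrite divr_gt0.
have gr x z : point_dist x z <= 3 * r -> `|logderiv g x - logderiv g z| < c.
  by move=> xz; apply: hr'; apply: le_lt_trans xz _; rewrite /r; lra.
pose q : R := expR (- c).
have q0 : 0 <= q := expR_ge0 _.
have q1 : q < 1 by rewrite expR_lt1 oppr_lt0.
have qr0 : 0 < (1 - q) * r by rewrite mulr_gt0// subr_gt0.
(* Makes the pigeonhole distance [1 / m.+1] at most the displacement that [contracting_fixed_point]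
   allows. *)
pose m := Num.trunc ((1 - q) * r)^-1.
have mq : m.+1%:R^-1 <= (1 - q) * r.
  by rewrite invf_ple ?posrE//; apply: ltW; exact: truncnS_gt.
exists (Num.trunc (m.+3%:R * W / c)).+1 => N x NN gN.
(* After a time from which [S] stays below its value there, the orbit decays at rate [2 c]; the
   total drop of [S], at least [c N], crosses the [m.+3] levels. *)
pose S k := logderiv (g ^+ k)%g x + (c + c) *+ k.
have S0 : S 0%N = 0 by rewrite /S expg0 logderiv1 mulr0n addr0.
have SW k : S k <= S k.+1 + W.
  rewrite /S logderiv_expgS mulrSr /W.
  have := gB ((g ^+ k)%g x); rewrite ler_norml => /andP[h _]; lra.
have SN : S N < - (m.+3%:R * W).
  apply: (@le_lt_trans _ _ (- (c *+ N))).
    by rewrite /S; move: gN; rewrite mulNrn !mulrnDl; lra.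
  rewrite ltrN2 -[c *+ N]mulr_natl -ltr_pdivrMr//; apply: lt_le_trans (truncnS_gt _) _.
  by rewrite ler_nat.
have time (i : 'I_m.+3) : exists k, [/\ (k < N)%N,
    - (i%:R * W) <= S k < - (i%:R * W) + W &
    forall l, (k < l <= N)%N -> S l <= S k].
  apply: hyperbolic_time => //; apply: lt_trans SN _.
  by rewrite ltrN2 ltr_pM2r// ltr_nat.
have [k hk] := choice time.
(* The windows of two levels are disjoint, so different levels give different times. *)
have k_lt (i j : 'I_m.+3) : (i < j)%N -> k i != k j.
  move=> ij; apply/eqP => kij.
  have [_ /andP[h1 _] _] := hk i; have [_ /andP[_ h2] _] := hk j.
  have : i.+1%:R * W <= j%:R * W by rewrite ler_pM2r// ler_nat.
  by move: h1 h2; rewrite kij -natr1 mulrDl mul1r; lra.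
have k_inj (i j : 'I_m.+3) : i != j -> k i != k j.
  rewrite -val_eqE /=; case: ltngtP => // [/k_lt//|/k_lt].
  by rewrite eq_sym.
suff close (i j : 'I_m.+3) : (k i < k j)%N ->
    point_dist ((g ^+ k i)%g x) ((g ^+ k j)%g x) < m.+1%:R^-1 ->
    exists z, hyperbolic_periodic_point g z.
  have [i [j [ij uij]]] := close_pair (fun i => (g ^+ k i)%g x).
  case: (ltngtP (k i) (k j)) (k_inj i j ij) => // kij _; first exact: close kij uij.
  by apply: close kij _; rewrite point_dist_sym.
move=> kij; set y := (g ^+ k i)%g x => yj.
pose n := (k j - k i)%N.
have n0 : (0 < n)%N by rewrite subn_gt0.
have gny : (g ^+ n)%g y = (g ^+ k j)%g x.
  by rewrite -diff1_mulE -expgnDr subnK// ltnW.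
have [_ _ kmax] := hk i; have [kjN _ _] := hk j.
have gy l : (l <= n)%N -> logderiv (g ^+ l)%g y <= - (c + c) *+ l.
  move=> ln; have [->|l0] := posnP l.
    by rewrite expg0 logderiv1 mulr0n.
  have := kmax (l + k i)%N; rewrite -{1}[k i]add0n ltn_add2r l0 /=.
  have -> : (l + k i <= N)%N.
    apply: leq_trans (ltnW kjN).
    by rewrite -[leqRHS](subnK (ltnW kij)) leq_add2r.
  move=> /(_ isT); rewrite /S logderiv_expgD -/y mulrnDr mulNrn; lra.
have gq z : point_dist y z <= 3 * r -> deriv (g ^+ n)%g z <= q.
  move=> yz; rewrite deriv_expR ler_expR.
  have := hyperbolic_time_contraction c0 gr gy (leqnn n) yz.
  move=> /le_trans; apply; rewrite -(prednK n0) mulrSr gerDr mulNrn oppr_le0.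
  by rewrite mulrn_wge0// ltW.
have [||z gz z1] := @contracting_fixed_point (g ^+ n)%g y q r _ r0 gq.
- by rewrite q0.
- by rewrite gny (le_trans (ltW yj)).
by exists z, n; split=> //; rewrite lt_eqF.
Qed.

End Contraction.

(** * Quasi-isometric embedding of a cyclic subgroup *)

Section CyclicSubgroup.
Variables (R : realType) (G : preTopologicalGroupType).
Implicit Types (f g : G) (d : G -> G -> R).

Lemma expgzN f n : expgz f (- n%:Z) = (f ^- n)%g.
Proof. by case: n => [|n //]; rewrite oppr0 /= expg0 invg1. Qed.

Lemma expgz_subn f m n : expgz f (m%:Z - n%:Z) = (f ^+ m * f ^- n)%g.
Proof.
have [nm|/ltnW mn] := leqP n m; first by rewrite subzn// [LHS]expgnFr.
by rewrite -opprB subzn// expgzN expgnFr// invgM invgK.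
Qed.

Lemma expgz_div f i j : (expgz f i * (expgz f j)^-1)%g = expgz f (i - j).
Proof.
have intE (k : int) : exists m n : nat, k = m%:Z - n%:Z.
  by case: k => k; [exists k, 0%N; rewrite subr0|exists 0%N, k.+1; rewrite sub0r].
have [p [q ->]] := intE i; have [r [s ->]] := intE j.
have -> : p%:Z - q%:Z - (r%:Z - s%:Z) = (p + s)%N%:Z - (r + q)%N%:Z.
  by rewrite !PoszD; ring.
rewrite !expgz_subn invgM invgK !expgnDr invgM !mulgA; congr (_ * _)%g.
rewrite -!mulgA; congr (_ * _)%g; apply: (can_inj (mulgK (f ^+ q)%g)).
by rewrite mulgVK -mulgA -expgnDr addnC expgnDr mulKg.
Qed.

(** Without torsion the exponent is unique, so the infimum is over a single value. *)
Lemma cayley_distE f i j : ~ torsion f ->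
  cayley_dist R f (expgz f i) (expgz f j) = `|i - j|%N%:R.
Proof.
move=> ft; rewrite /cayley_dist expgz_div.
have inj k l : expgz f k = expgz f l -> k = l.
  move=> kl; apply/eqP; rewrite -subr_eq0; apply/eqP.
  have : expgz f (k - l) = 1%g by rewrite -expgz_div kl mulgV.
  case: (k - l) => n /= fn; first by case: n fn => // n fn; case: ft; exists n.+1.
  by case: ft; exists n.+1 => //; rewrite -[LHS]invgK fn invg1.
rewrite (_ : [set _ | _ in _] = [set `|i - j|%N%:R])  ?inf1//.
by apply/seteqP; split=> [_ [k /= /inj -> <-]//|_ ->]; exists (i - j).
Qed.

Section Metric.
Variable d : G -> G -> R.
Hypotheses (dP : pseudometric d) (dR : right_invariant d).

Lemma dist_expgz f k : d (expgz f k) 1%g = d (f ^+ `|k|%N)%g 1%g.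
Proof.
case: k => n //=; have [_ _ sym _] := dP.
by rewrite sym (dist_quotient dR) mul1g invgK.
Qed.

(** Right invariance reduces a pair of powers to one power and the identity, and symmetry reduces
    that to a natural exponent. *)
Lemma qi_embedded_cyclicP f : ~ torsion f ->
  qi_embedded (cyclic_subgroup f) (cayley_dist R f) d <->
  exists K C : R, [/\ 1 <= K, 0 <= C & forall n : nat,
    K^-1 * n%:R - C <= d (f ^+ n)%g 1%g <= K * n%:R + C].
Proof.
move=> ft; split=> [[K [C [K1 C0 KC]]]|[K [C [K1 C0 KC]]]]; exists K, C; split=> //.
  move=> n; have := KC (expgz f n%:Z) (expgz f 0).
  rewrite cayley_distE// subr0 absz_nat; apply; first by exists n%:Z.
  by exists 0.
move=> _ _ [i _ <-] [j _ <-].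
by rewrite cayley_distE// (dist_quotient dR) expgz_div dist_expgz.
Qed.

End Metric.
End CyclicSubgroup.

(** * Hyperbolic periodic points and distortion *)

Section Main.
Variables (R : realType) (M : manifold1).
Local Notation pt := (pt R M).
Local Notation diff1 := (diff1 R M).
Implicit Types (x y z : pt) (f g : diff1).

Lemma logdist_maximal : maximal_pseudometric (@logdist R M).
Proof.
split; first exact: logdist_continuous_right_invariant.
move=> rho /logdist_dominates[K [C h]]; exists K, C; exact: h.
Qed.

Lemma hyperbolicV f z :
  hyperbolic_periodic_point (f^-1)%g z -> hyperbolic_periodic_point f z.
Proof.
move=> [q [q0 fz dz]]; rewrite expVgn in fz dz.
have {}fz : (f ^+ q)%g z = z by rewrite -{1}fz diff1_mulKV.
exists q; split=> //; apply: contra_neq dz => dz.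
have := derivM (f ^- q)%g (f ^+ q)%g z.
by rewrite mulVg deriv1 dz mulr1 fz.
Qed.

Lemma logderiv_fixed g z n : g z = z ->
  logderiv (g ^+ n)%g z = n%:R * logderiv g z.
Proof.
move=> gz; have gnz m : (g ^+ m)%g z = z.
  by elim: m => [//|m IH]; rewrite expgS diff1_mulE IH.
elim: n => [|n IH]; first by rewrite expg0 logderiv1 mul0r.
by rewrite logderiv_expgS IH gnz -natr1 mulrDl mul1r.
Qed.

(** For an arbitrary maximal [d], the chain rule at the fixed point [z] of [f ^+ q] gives [n |L| <=
    logdist (f^(nq)) 1 <= K' q d(f^n, 1) + C']; the upper linear bound is subadditivity. *)
Lemma hyperbolic_undistorted f z :
  hyperbolic_periodic_point f z -> C1_undistorted f.
Proof.
move=> [q [q0 fz dz]].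
have L0 : logderiv (f ^+ q)%g z != 0.
  by rewrite /logderiv ln_eq0 ?deriv_gt0.
set L := logderiv _ _ in L0; have absL : 0 < `|L| by rewrite normr_gt0.
have fqn n : logderiv ((f ^+ n) ^+ q)%g z = n%:R * L.
  by rewrite -expgnA mulnC expgnA logderiv_fixed.
have nt : ~ torsion f.
  move=> [n n0 fn]; have := fqn n; rewrite fn expg1n logderiv1 => /esym/eqP.
  by rewrite mulf_eq0 pnatr_eq0 (negbTE L0) orbF -[_ == _]negbK -lt0n n0.
move=> [[d [dC dmax]]|//]; apply.
have [dP _ dR] := dC; have [dge0 _ _ _] := dP.
apply/(qi_embedded_cyclicP dP dR nt).
have [K [C KC]] := dmax _ (@logdist_continuous_right_invariant R M).
pose K' := `|K| + 1; pose C' := `|C|.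
have K'1 : 1 <= K' by rewrite lerDr.
have C'0 : 0 <= C' := normr_ge0 C.
have {}KC g : logdist g 1%g <= K' * d g 1%g + C'.
  apply: le_trans (KC _ _) _; apply: lerD; last exact: ler_norm.
  by apply: ler_wpM2r => //; have := ler_norm K; rewrite /K'; lra.
have lower n : n%:R * `|L| <= K' * (q%:R * d (f ^+ n)%g 1%g) + C'.
  have := le_logdist ((f ^+ n) ^+ q)%g 1%g z.
  rewrite fqn logderiv1 subr0 normrM normr_nat => /le_trans; apply.
  apply: le_trans (KC _) _; rewrite lerD2r ler_wpM2l//; first by lra.
  exact: dist_expg1.
have q1 : 1 <= q%:R :> R by rewrite ler1n.
pose P := K' * q%:R; have P1 : 1 <= P by rewrite /P mulr_ege1.
have P0 : 0 < P by lra.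
have PL : 0 < P / `|L| by rewrite divr_gt0.
(* One constant meets three demands: 1 makes it at least 1, [P / |L|] serves the lower bound and
   [d f 1] the upper one. *)
exists (1 + P / `|L| + d f 1%g), C'; split=> //.
  by rewrite -addrA lerDl addr_ge0// ltW.
set A := 1 + _ + _; have d1 := dge0 f 1%g.
have A0 : 0 < A by rewrite /A; lra.
move=> n; apply/andP; split; last first.
  apply: le_trans (dist_expg1 dP dR f n) _.
  rewrite mulrC; apply: (@le_trans _ _ (A * n%:R)); last by rewrite lerDl.
  by rewrite ler_wpM2r// /A; lra.
rewrite lerBlDr mulrC ler_pdivrMr//.
have h1 : n%:R <= (P / `|L|) * (d (f ^+ n)%g 1%g + C').
  rewrite mulrAC ler_pdivlMr//; apply: le_trans (lower n) _.
  rewrite mulrDr mulrA lerD2l ler_peMl//.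
have h2 : 0 <= d (f ^+ n)%g 1%g + C' by rewrite addr_ge0.
by apply: le_trans h1 _; rewrite mulrC ler_wpM2l// /A; lra.
Qed.

Lemma undistorted_hyperbolic f : C1_undistorted f ->
  exists z, hyperbolic_periodic_point f z.
Proof.
move=> und; apply: contrapT => noh; apply: und.
have [ft|ft] := pselect (torsion f); [by right|left].
exists (@logdist R M); first exact: logdist_maximal.
have dP := @logdist_pseudometric R M; have dR := @logdist_right_invariant R M.
move=> /(qi_embedded_cyclicP dP dR ft)[K [C [K1 C0 KC]]].
pose a := K^-1; have a0 : 0 < a by rewrite invr_gt0; lra.
(* Thus [3 c = a / 2]: for [n > 2 C / a] the lower bound [a n - C] exceeds [3 c n], the decay asked
   by [decay_hyperbolic]. *)
pose c := a / 6; have c0 : 0 < c by rewrite divr_gt0.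
have [N1 h1] := decay_hyperbolic f c0.
have [N2 h2] := decay_hyperbolic (f^-1)%g c0.
pose n := (N1 + N2 + (Num.trunc (2 * C / a)).+1)%N.
have nN1 : (N1 <= n)%N by rewrite /n -addnA leq_addr.
have nN2 : (N2 <= n)%N by rewrite /n addnAC leq_addl.
have nC : C < a / 2 * n%:R.
  have : 2 * C / a < n%:R.
    by apply: lt_le_trans (truncnS_gt _) _; rewrite ler_nat leq_addl.
  by rewrite ltr_pdivrMr//; lra.
have /andP[low _] := KC n.
have : ~ forall x, `|logderiv (f ^+ n)%g x| <= (c + c + c) *+ n.
  move=> h; have : logdist (f ^+ n)%g 1%g <= (c + c + c) *+ n.
    by apply: logdist_le => x; rewrite logderiv1 subr0.
  move: low; rewrite -/a -[(c + c + c) *+ n]mulr_natl /c.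
  move: (logdist _ _) => t; lra.
move=> /existsNP[x /negP]; rewrite -ltNge => xn; apply: noh.
(* A large positive value at [x] is a large negative one for the inverse at [(f ^+ n) x], and
   [hyperbolicV] brings the point found there back to [f]. *)
have [fx|fx] := leP 0 (logderiv (f ^+ n)%g x).
  have [z /hyperbolicV hz] : exists z, hyperbolic_periodic_point (f^-1)%g z.
    apply: (h2 n ((f ^+ n)%g x)) => //.
    rewrite expVgn logderivV mulNrn lerN2 ltW//.
    by rewrite ger0_norm in xn.
  by exists z.
apply: (h1 n x) => //.
by rewrite mulNrn lerNr ltW// -(ltr0_norm fx).
Qed.

End Main.

Theorem theorem1p1 (R : realType) (M : manifold1) (f : diff1 R M) :
  C1_undistorted f <-> exists x : pt R M, hyperbolic_periodic_point f x.
Proof.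
split; first exact: undistorted_hyperbolic.
by move=> [x]; exact: hyperbolic_undistorted.
Qed.
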